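(* Let $\Delta t>0$ be arbitrary, $n\ge 1$, and let $\phi^{n+1},\mu^{n+\frac12},r^{n+1},Q^{n+1}$ be obtained from $\phi^n,\overline{\phi}^n,\overline{\phi}^{n-1},r^n$ by one step of the second-order RAV scheme described in the context. Then the scheme is unconditionally energy stable in the following sense. If $Q^{n+1}\ge 0$, then $$E[\phi^{n+1}]-(E[\phi^{n}]+r^{n})=E[\phi^{n+1}]+r^{n+1}-(E[\phi^{n}]+r^{n})\leq 0.$$ If $Q^{n+1}<0$, then $$E[\phi^{n+1}]+r^{n+1}-(E[\phi^{n}]+r^{n})= 0.$$ Moreover, if $Q^{n+1}-r^{n}\geq 0$, then the scheme satisfies the original energy dissipation law $E[\phi^{n+1}]-E[\phi^{n}]\leq 0$.
   Context: Let $\Omega\subset\mathbb{R}^d$ ($d=2,3$) be the domain, $\epsilon>0$, and $F:\mathbb{R}\to\mathbb{R}$ a (smooth) energy density function. The free energy is $$E[\phi]=\int_\Omega\left(\frac{\epsilon^2}{2}|\nabla\phi|^2+F(\phi)\right)d\bm{x}.$$ It is assumed to be bounded from below, and $C_0$ is a constant with $\tilde E[\phi]:=E[\phi]+C_0>0$ for all $\phi$. The gradient flow approximated is $\partial_t\phi=\Delta\mu$, $\mu=-\epsilon^2\Delta\phi+F'(\phi)$, with either periodic boundary conditions or $\frac{\partial\phi}{\partial\bm{n}}|_{\partial\Omega}=\frac{\partial\mu}{\partial\bm{n}}|_{\partial\Omega}=0$. The time-discrete functions satisfy the same boundary conditions and are regular enough for all expressions to make sense. Second-order RAV scheme (time step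 $\Delta t>0$, stabilization parameter $\lambda>0$). Given functions $\phi^n,\overline{\phi}^n,\overline{\phi}^{n-1}$ and a real number $r^n$ (with $r^0=0$ initially), $\phi^{n+1},\mu^{n+\frac12}$ (functions) and $r^{n+1}$ (real) satisfy $$\frac{\phi^{n+1}-\phi^{n}}{\Delta t}=\Delta \mu^{n+\frac{1}{2}},$$ $$\mu^{n+\frac{1}{2}}=-\epsilon^2\Delta \phi^{n+\frac{1}{2}}+\lambda \phi^{n+\frac{1}{2}}+F'((\overline{\phi}^* )^{n+\frac{1}{2}})-\lambda(\overline{\phi}^* )^{n+\frac{1}{2}},$$ $$r^{n+1}=0 \text{ if } Q^{n+1}\ge 0,\qquad r^{n+1}=Q^{n+1}\text{ if } Q^{n+1}<0,$$ $$\overline{\phi}^{n+1}=\xi^{n+1}\phi^{n+1},\qquad \xi^{n+1}=\frac{\tilde{E}[\phi^{n+1}]+r^{n+1}}{\tilde{E}[\phi^{n+1}]},$$ where $\phi^{n+\frac12}=\frac12(\phi^{n+1}+\phi^n)$, $(\overline{\phi}^* )^{n+\frac{1}{2}}=\frac{3}{2}\overline{\phi}^n-\frac{1}{2}\overline{\phi}^{n-1}$, and $$Q^{n+1}=r^n+\int_\Omega \left(F'((\overline{\phi}^* )^{n+\frac{1}{2}})-\lambda(\overline{\phi}^* )^{n+\frac{1}{2}}\right)(\phi^{n+1}-\phi^n)\, d\bm{x}$$ $$\qquad-\left(\int_\Omega \left(F(\phi^{n+1})-\frac{\lambda}{2}(\phi^{n+1})^2\right) d\bm{x}-\int_\Omega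 \left(F(\phi^{n})-\frac{\lambda}{2}(\phi^{n})^2\right) d\bm{x}\right)+\Delta t\Vert \nabla\mu^{n+\frac{1}{2}}\Vert_{L^2}^2.$$ *)

(* Defs.v *)
From HB Require Import structures.
From mathcomp Require Import all_boot all_order all_algebra.
From mathcomp Require Import all_classical all_reals all_analysis.

Set Implicit Arguments.
Unset Strict Implicit.
Unset Printing Implicit Defensive.
Import Order.TTheory GRing.Theory Num.Theory.
Import numFieldNormedType.Exports.

Local Open Scope classical_set_scope.
Local Open Scope ring_scope.

(* R^d is 'rV[R]_d for differentiation (normed module structure) and
   d.-tuple R for integration (product sigma-algebra).  The d-dimensional
   Lebesgue measure is the d-fold product of the one-dimensional one,
   transported along R * R^d ~ R^(d+1). *)
Section LebesgueRd.
Context {R : realType}.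
Local Notation tupR d := (d.-tuple (measurableTypeR R)).

Definition cons_tup d (p : measurableTypeR R * tupR d) : tupR d.+1 :=
  [tuple of p.1 :: p.2].

Lemma measurable_cons_tup d : measurable_fun [set: _] (@cons_tup d).
Proof. exact: (measurable_cons measurable_fst measurable_snd). Qed.

Section step.
Variables (d : nat) (m : {sigma_finite_measure set (tupR d) -> \bar R}).

Definition lebesgue_step : set (tupR d.+1) -> \bar R :=
  pushforward (@lebesgue_measure R \x m)%E (@cons_tup d).

HB.instance Definition _ := Measure.copy lebesgue_step
  (measure_function_pushforward__canonical__measure_function_Measure
    (@lebesgue_measure R \x m)%E (@measurable_cons_tup d)).

Let uncons (t : tupR d.+1) : measurableTypeR R * tupR d :=
  (thead t, [tuple of behead t]).

Lemma lebesgue_step_sigma_finite : sigma_finite [set: tupR d.+1] lebesgue_step.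
Proof.
have mu : measurable_fun [set: tupR d.+1] uncons.
  apply: measurable_fun_pair; last exact: measurable_behead.
  exact: (measurable_tnth (d := _) ord0).
have /sigma_finiteP[F [TF ndF Foo]] := sigma_finiteT (@lebesgue_measure R).
have /sigma_finiteP[G [TG ndG Goo]] := sigma_finiteT m.
exists (fun i => uncons @^-1` (F i `*` G i)).
  rewrite -preimage_bigcup; apply/esym; rewrite -subTset => t _ /=.
  have [i _ Fi] : (\bigcup_i F i) (uncons t).1 by rewrite -TF.
  have [j _ Gj] : (\bigcup_i G i) (uncons t).2 by rewrite -TG.
  exists (maxn i j) => //; split.
    by move: Fi; exact/subsetPset/ndF/leq_maxl.
  by move: Gj; exact/subsetPset/ndG/leq_maxr.
move=> i; have [mF Fi] := Foo i; have [mG Gi] := Goo i; split.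
  by rewrite -[X in measurable X]setTI; apply: mu => //; exact: measurableX.
rewrite /lebesgue_step /pushforward -comp_preimage.
rewrite (_ : uncons \o _ = id) ?preimage_id.
  by rewrite product_measure1E// lte_mul_pinfty// ge0_fin_numE.
by apply/funext => -[x t] /=; congr pair; exact/val_inj.
Qed.

HB.instance Definition _ := @Measure_isSigmaFinite.Build _ _ _
  lebesgue_step lebesgue_step_sigma_finite.
End step.

Fixpoint lebesgue_Rd d : {sigma_finite_measure set (tupR d) -> \bar R} :=
  match d with
  | 0 => \d_([tuple] : tupR 0)
  | d'.+1 => lebesgue_step (lebesgue_Rd d')
  end.

Definition rowvec d (t : tupR d) : 'rV[R]_d := \row_i tnth t i.

Definition integral_over d (Om : set 'rV[R]_d) (f : 'rV[R]_d -> R) : R :=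
  \int[lebesgue_Rd d]_(t in @rowvec d @^-1` Om) f (rowvec t).

End LebesgueRd.

Section calculus.
Context {R : realType} {d : nat}.
Implicit Types (f u : 'rV[R]_d -> R) (x p n : 'rV[R]_d).

Definition partial (i : 'I_d) f : 'rV[R]_d -> R :=
  fun x => 'D_(delta_mx 0 i) f x.

Definition grad f x : 'rV[R]_d := \row_i partial i f x.

Definition laplacian f x : R := \sum_(i < d) partial i (partial i f) x.

(* `|v| is the sup norm on 'rV[R]_d, hence this Euclidean square. *)
Definition sqnorm2 (v : 'rV[R]_d) : R := \sum_(i < d) v 0 i ^+ 2.

Definition C1 f : Prop :=
  (forall x, differentiable f x) /\ (forall i, continuous (partial i f)).

Definition C2 f : Prop := C1 f /\ (forall i, C1 (partial i f)).

End calculus.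

Definition smooth {R : realType} (F : R -> R) : Prop :=
  forall (k : nat) (x : R), derivable (derive1n k F) x 1.

Section boundary.
Context {R : realType} {d : nat}.
Implicit Types (Om S : set 'rV[R]_d) (a b p n : 'rV[R]_d) (u : 'rV[R]_d -> R).

Definition topological_boundary Om : set 'rV[R]_d := closure Om `\` interior Om.

(* Near p, Om is a strict sublevel set of a C^1 function rho whose gradient
   does not vanish at p; n is the normalised gradient.  The vector n depends
   on Om and p only. *)
Definition outward_unit_normal Om p n : Prop :=
  exists rho : 'rV[R]_d -> R,
    [/\ C1 rho, rho p = 0, grad rho p != 0,
        \forall x \near p, Om x <-> rho x < 0
      & n = (Num.sqrt (sqnorm2 (grad rho p)))^-1 *: grad rho p].

Definition singular_boundary Om : set 'rV[R]_d :=
  [set p | topological_boundary Om p /\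
           ~ exists n, outward_unit_normal Om p n].

(* (d-1)-dimensional Hausdorff measure zero, for a compact set S: countable
   covers may be replaced by finite covers by open balls. *)
Definition surface_null S : Prop :=
  forall e : R, 0 < e ->
    exists s : seq ('rV[R]_d * R),
      [/\ (forall cr, cr \in s -> 0 < cr.2),
          S `<=` [set x | exists2 cr, cr \in s & ball cr.1 cr.2 x]
        & \sum_(cr <- s) cr.2 ^+ d.-1 < e].

(* Bounded domain with piecewise C^1 boundary: edges, corners and similar
   exceptional points are allowed as long as they carry no surface measure. *)
Definition piecewise_C1_domain Om : Prop :=
  [/\ open Om, connected Om, Om !=set0, bounded_set Om
    & surface_null (singular_boundary Om)].

Definition open_box a b : set 'rV[R]_d :=
  [set x | forall i, a 0 i < x 0 i < b 0 i].

End boundary.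

(* Periodic a b: the periodic cell is the box with corners a and b.
   NoFlux Om: homogeneous Neumann conditions on the boundary of Om. *)
Variant setting (R : realType) (d : nat) :=
  | Periodic of 'rV[R]_d & 'rV[R]_d
  | NoFlux of set 'rV[R]_d.
Arguments Periodic {R d}.
Arguments NoFlux {R d}.

Section gradient_flow.
Context {R : realType} {d : nat}.
Implicit Types (S : setting R d) (u v phi : 'rV[R]_d -> R) (F : R -> R).

Definition domain S : set 'rV[R]_d :=
  match S with
  | Periodic a b => open_box a b
  | NoFlux Om => Om
  end.

Definition admissible_domain S : Prop :=
  match S with
  | Periodic a b => forall i, a 0 i < b 0 i
  | NoFlux Om => piecewise_C1_domain Om
  end.

Definition boundary_condition S u : Prop :=
  match S with
  | Periodic a b =>
      forall i x, u (x + (b 0 i - a 0 i) *: delta_mx 0 i) = u x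
  | NoFlux Om => forall p n, outward_unit_normal Om p n -> 'D_n u p = 0
  end.

(* A C^2 function on the closure of the domain is represented by a C^2
   function on R^d; only its restriction to the closure is ever used (for the
   periodic setting, it is its periodic extension). *)
Definition admissible S u : Prop := C2 u /\ boundary_condition S u.

Definition energy S (eps : R) F phi : R :=
  integral_over (domain S)
    (fun x => eps ^+ 2 / 2 * sqnorm2 (grad phi x) + F (phi x)).

Definition L2norm_sq_grad S u : R :=
  integral_over (domain S) (fun x => sqnorm2 (grad u x)).

Definition midpoint u v : 'rV[R]_d -> R := fun x => (u x + v x) / 2.

Definition extrapolation u v : 'rV[R]_d -> R :=
  fun x => 3 / 2 * u x - 1 / 2 * v x.

(* phi_star is the extrapolated field, phi0 and phi1 the old and new fields. *)
Definition RAV_Q S F (lam dt r0 : R) phi_star phi0 phi1 mu : R :=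
  r0
  + integral_over (domain S)
      (fun x => (derive1 F (phi_star x) - lam * phi_star x) * (phi1 x - phi0 x))
  - (integral_over (domain S) (fun x => F (phi1 x) - lam / 2 * phi1 x ^+ 2)
     - integral_over (domain S) (fun x => F (phi0 x) - lam / 2 * phi0 x ^+ 2))
  + dt * L2norm_sq_grad S mu.

(* One step from time index n to n.+1; mu n stands for mu^(n+1/2). *)
Record RAV2_step S (eps : R) F (lam dt C0 : R) (n : nat)
    (phi phibar mu : nat -> 'rV[R]_d -> R) (r Q xi : nat -> R) : Prop := {
  RAV2_phi : forall x, domain S x ->
    (phi n.+1 x - phi n x) / dt = laplacian (mu n) x ;
  RAV2_mu : forall x, domain S x ->
    let phi_half := midpoint (phi n.+1) (phi n) in
    let phi_star := extrapolation (phibar n) (phibar n.-1) in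
    mu n x = - eps ^+ 2 * laplacian phi_half x + lam * phi_half x
             + derive1 F (phi_star x) - lam * phi_star x ;
  RAV2_Q : Q n.+1 =
    RAV_Q S F lam dt (r n) (extrapolation (phibar n) (phibar n.-1))
      (phi n) (phi n.+1) (mu n) ;
  RAV2_r_ge0 : 0 <= Q n.+1 -> r n.+1 = 0 ;
  RAV2_r_lt0 : Q n.+1 < 0 -> r n.+1 = Q n.+1 ;
  RAV2_xi : xi n.+1 = (energy S eps F (phi n.+1) + C0 + r n.+1)
                      / (energy S eps F (phi n.+1) + C0) ;
  RAV2_phibar : forall x, domain S x ->
    phibar n.+1 x = xi n.+1 * phi n.+1 x
}.

End gradient_flow.

(* Main.v *)
Require Import Defs.
From HB Require Import structures.
From mathcomp Require Import all_boot all_order all_algebra.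
From mathcomp Require Import finmap.
From mathcomp Require Import all_classical all_reals all_analysis.
From mathcomp Require Import measurable_realfun zify ring lra.
Import Order.TTheory GRing.Theory Num.Theory.
Import numFieldNormedType.Exports.
Local Open Scope classical_set_scope.
Local Open Scope ring_scope.

Set Implicit Arguments.
Unset Strict Implicit.
Unset Printing Implicit Defensive.

(** Testing the equation for phi with mu and the equation for mu with
    phi^(n+1) - phi^n gives two expressions for the integral of
    mu * (phi^(n+1) - phi^n).  The definition of Q collects exactly the terms
    of their difference that are not already in the energy, and the lambda
    terms cancel because (phi^(n+1) + phi^n) / 2 * (phi^(n+1) - phi^n) is half
    a difference of squares.  The result is the exact balance [energy_balance]

      E[phi^(n+1)] - E[phi^n] = r^n - Q^(n+1),

    and the three claims follow by inserting the rule that defines r^(n+1).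

    The analytic content is the integration by parts in both tests
    ([green_first_identity]).  Only fields whose normal component vanishes on
    the boundary occur, or fields that are periodic.  For those the integral of
    the divergence vanishes, and this can be proved without surface measures
    or boundary charts.

    - Periodic cell: Tonelli along one coordinate and the fundamental theorem
      of calculus ([integral_box_partial]).  The same lemma shows that a field
      with compact support has zero total divergence.

    - Regular boundary point, where the domain is {rho < 0} with grad rho <> 0:
      multiply the field Y by a smooth step of rho / delta.  The product has
      compact support, so its divergence integrates to zero.  The error lives
      in the slab {-delta < rho < 0}, whose volume is O(delta) because some
      partial derivative of rho is bounded below ([vol_slab]).  The error
      integrand is O(1) + o(1) / delta there, since grad rho . Y is continuous
      and vanishes on {rho = 0}
      ([integral_divergence_boundary]).

    - Globally: peel off plateau functions supported in finitely many good
      balls ([integral_divergence_cover]).  The exceptional boundary points are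
      cut off first by a product of functions 1 - plateau over small balls of
      radii r_k: the gradient of such a factor is O(1 / r_k) on a set of
      volume O(r_k ^ d), so the cost is O(sum r_k ^ (d - 1)), which is as small
      as desired because these points carry no surface measure
      ([divergence_theorem]). *)

(** * Borel measurability on row vectors *)

Section measurability.
Context {R : realType}.
Local Notation tupR d := (d.-tuple (measurableTypeR R)).

Lemma ball_rowvecP d (c x : 'rV[R]_d) (r : R) :
  0 < r -> ball c r x <-> forall i, `|c 0 i - x 0 i| < r.
Proof.
move=> r0; split => [[_ h] i|h]; first exact: h.
by split => // i j; rewrite ord1; exact: h.
Qed.

Lemma bigcap_ord_measurable d (T : measurableType d) n (A : 'I_n -> set T) :
  (forall i, measurable (A i)) -> measurable [set x | forall i, A i x].
Proof.
move=> mA.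
rewrite (_ : [set x | _] = \bigcap_(i in [set: 'I_n]) A i).
  exact: fin_bigcap_measurable.
by apply/seteqP; split => x /= h i; [move=> _|]; exact: h.
Qed.

Lemma measurable_rowvec_box d (I : 'I_d -> set R) :
  (forall i, measurable (I i)) ->
  measurable (@rowvec R d @^-1` [set x | forall i, I i (x 0 i)]).
Proof.
move=> mI; rewrite (_ : _ @^-1` _ = [set t : tupR d | forall i, I i (tnth t i)]).
  apply: (@bigcap_ord_measurable _ _ _ (fun i (t : tupR d) => I i (tnth t i))).
  by move=> i; rewrite -[X in measurable X]setTI; exact: (measurable_tnth i measurableT (mI i)).
by apply/seteqP; split => t /= h i; have := h i; rewrite /= ?mxE.
Qed.

(** An open set is the union of the countably many rational cubes that it
    contains, and cubes are finite intersections of coordinate conditions. *)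
Lemma measurable_rowvec_open d (O : set 'rV[R]_d) :
  open O -> measurable (@rowvec R d @^-1` O).
Proof.
move=> oO.
pose q2 (q : 'rV[rat]_d) : 'rV[R]_d := map_mx ratr q.
pose B (qk : 'rV[rat]_d * nat) : set (tupR d) :=
  if `[< ball (q2 qk.1) qk.2.+1%:R^-1 `<=` O >] then
    @rowvec R d @^-1` ball (q2 qk.1) qk.2.+1%:R^-1 else set0.
rewrite (_ : _ @^-1` O = \bigcup_(qk in setT) B qk); last first.
  apply/seteqP; split => [t Ot|t [[q k] _]]; last first.
    by rewrite /B /=; case: asboolP => // h /h.
  have /nbhs_ballP[e /= e0 eO] : nbhs (rowvec t) O by exact: open_nbhs_nbhs.
  have [k ke] : exists k, k.+1%:R^-1 < e / 2.
    have e20 : 0 < e / 2 by rewrite divr_gt0.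
    exists (Num.truncn (e / 2)^-1); rewrite invf_plt ?posrE//.
    exact: truncnS_gt.
  have k0 : 0 < k.+1%:R^-1 :> R by rewrite invr_gt0.
  have hq i : exists q : rat, `|ratr q - rowvec t 0 i| < k.+1%:R^-1.
    have /rat_in_itvoo[q] :
        rowvec t 0 i - k.+1%:R^-1 < rowvec t 0 i + k.+1%:R^-1.
      by rewrite ltrD2l gtrN.
    rewrite in_itv/= -ltr_distl => h.
    by exists q.
  have [f hf] := choice hq.
  exists (\row_i f i, k) => //; rewrite /B /=.
  have qt : ball (q2 (\row_i f i)) k.+1%:R^-1 (rowvec t).
    by apply/ball_rowvecP => // i; rewrite !mxE; have := hf i; rewrite mxE.
  case: asboolP => // -[] y qy; apply: eO.
  apply: (@ball_splitr _ _ (q2 (\row_i f i))).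
    exact: le_ball (ltW ke) _ qt.
  exact: le_ball (ltW ke) _ qy.
apply: countable_bigcupT_measurable => // -[q k]; rewrite /B /=.
case: asboolP => // _.
have k0 : 0 < k.+1%:R^-1 :> R by rewrite invr_gt0.
rewrite (_ : ball _ _ = [set x : 'rV[R]_d |
    forall i, ball (q2 q 0 i) k.+1%:R^-1 (x 0 i)]).
  apply: (@measurable_rowvec_box _ (fun i => ball (q2 q 0 i) k.+1%:R^-1)) => i.
  by apply: open_measurable; exact: ball_open.
by apply/seteqP; split => x /(ball_rowvecP _ _ k0).
Qed.

Lemma measurable_fun_rowvec d (f : 'rV[R]_d -> R) :
  continuous f -> measurable_fun setT (f \o @rowvec R d).
Proof.
move=> cf; apply: (measurability _ (RGenOpens.measurableE R)).
move=> _ [_ [a [b ->] <-]]; rewrite setTI comp_preimage.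
by apply: measurable_rowvec_open; apply: open_comp => // x _; exact: cf.
Qed.

End measurability.

(** * Tonelli along an arbitrary coordinate *)

Section tonelli.
Context {R : realType}.
Local Notation tupR d := (d.-tuple (measurableTypeR R)).

Definition insert_coord d (i : 'I_d.+1) (t : measurableTypeR R) (y : tupR d) :
    tupR d.+1 :=
  [tuple if unlift i j is Some k then tnth y k else t | j < d.+1].

Lemma tnth_insert_coord d (i : 'I_d.+1) t (y : tupR d) :
  tnth (insert_coord i t y) i = t.
Proof. by rewrite tnth_mktuple unlift_none. Qed.

Lemma tnth_insert_coord_lift d (i : 'I_d.+1) t (y : tupR d) k :
  tnth (insert_coord i t y) (lift i k) = tnth y k.
Proof. by rewrite tnth_mktuple liftK. Qed.

Lemma rowvec_insert_coord d (i : 'I_d.+1) t (y : tupR d) :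
  rowvec (insert_coord i t y) =
  t *: delta_mx 0 i + rowvec (insert_coord i 0 y).
Proof.
apply/rowP => j; rewrite !mxE/=.
case: (unliftP i j) => [k ->|->].
  by rewrite !tnth_insert_coord_lift eq_sym (negbTE (neq_lift _ _)) mulr0 add0r.
by rewrite !tnth_insert_coord eqxx mulr1 addr0.
Qed.

Lemma measurable_insert_coord d (i : 'I_d.+1) :
  measurable_fun [set: measurableTypeR R * tupR d]
    (fun p => insert_coord i p.1 p.2).
Proof.
apply/measurable_fun_tnthP => j; rewrite /comp.
case: (unliftP i j) => [k ->|->].
  rewrite [X in measurable_fun _ X](_ : _ = (@tnth d _)^~ k \o snd).
    by apply: measurableT_comp => //; exact: measurable_tnth.
  by apply/funext => p /=; rewrite tnth_insert_coord_lift.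
rewrite [X in measurable_fun _ X](_ : _ = fst) //.
by apply/funext => p /=; rewrite tnth_insert_coord.
Qed.

Lemma measurable_insert_coordl d (i : 'I_d.+1) (y : tupR d) :
  measurable_fun [set: measurableTypeR R] (fun t => insert_coord i t y).
Proof.
exact: (measurableT_comp (measurable_insert_coord i)
  (measurable_fun_pair (@measurable_id _ _ setT) (measurable_cst y))).
Qed.

Lemma insert_coord0 d t (y : tupR d) : insert_coord ord0 t y = cons_tup (t, y).
Proof.
apply: eq_from_tnth => j; case: (unliftP ord0 j) => [k ->|->].
  by rewrite tnth_insert_coord_lift /cons_tup tnthS.
by rewrite tnth_insert_coord.
Qed.

Lemma insert_coordS d (j : 'I_d.+1) s t (y : tupR d) :
  insert_coord (lift ord0 j) t (cons_tup (s, y)) =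
  cons_tup (s, insert_coord j t y).
Proof.
apply: eq_from_tnth => k; case: (unliftP (lift ord0 j) k) => [l ->|->].
  rewrite tnth_insert_coord_lift.
  case: (unliftP ord0 l) => [m ->|->].
    rewrite (_ : lift (lift ord0 j) (lift ord0 m) = lift ord0 (lift j m)).
      by rewrite !tnthS tnth_insert_coord_lift.
    by apply/val_inj; rewrite /= /bump /=; case: leqP => /=; lia.
  by rewrite (_ : lift (lift ord0 j) ord0 = ord0) //; exact/val_inj.
by rewrite tnth_insert_coord tnthS tnth_insert_coord.
Qed.

Local Open Scope ereal_scope.

Lemma ge0_integral_cons d (f : tupR d.+1 -> \bar R) :
  measurable_fun setT f -> (forall x, 0 <= f x) ->
  \int[lebesgue_Rd d.+1]_x f x =
  \int[(lebesgue_measure \x lebesgue_Rd d)%E]_p f (cons_tup p).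
Proof.
move=> mf f0.
transitivity (\int[pushforward
    (lebesgue_measure \x lebesgue_Rd d)%E (@cons_tup R d)]_x f x) => //.
by rewrite (ge0_integral_pushforward (@measurable_cons_tup R d)).
Qed.

Lemma tonelli_coord0 d (f : tupR d.+1 -> \bar R) :
  measurable_fun setT f -> (forall x, 0 <= f x) ->
  \int[lebesgue_Rd d.+1]_x f x =
  \int[lebesgue_Rd d]_y \int[lebesgue_measure]_t f (insert_coord ord0 t y).
Proof.
move=> mf f0; rewrite ge0_integral_cons// fubini_tonelli2//.
  apply: eq_integral => y _; apply: eq_integral => t _.
  by rewrite insert_coord0.
by apply: measurableT_comp mf _; exact: measurable_cons_tup.
Qed.

(** The measure is built by adding coordinates at the front, so only the first
    coordinate can be integrated first by definition.  Induction on the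
    dimension exchanges any other coordinate with the ones before it. *)
Lemma tonelli_coord d (i : 'I_d.+1) (f : tupR d.+1 -> \bar R) :
  measurable_fun setT f -> (forall x, 0 <= f x) ->
  \int[lebesgue_Rd d.+1]_x f x =
  \int[lebesgue_Rd d]_y \int[lebesgue_measure]_t f (insert_coord i t y).
Proof.
elim: d i f => [|d IH] i f mf f0; case: (unliftP ord0 i) => [j ij|->].
- by case: j ij.
- exact: tonelli_coord0.
- have mfc : measurable_fun setT (f \o @cons_tup R d.+1).
    by apply: measurableT_comp mf _; exact: measurable_cons_tup.
  rewrite ge0_integral_cons// fubini_tonelli1//.
  have mfi : measurable_fun setT
      (fun p : tupR d.+1 * measurableTypeR R => f (insert_coord i p.2 p.1)).
    apply: measurableT_comp mf _.
    exact: (measurableT_comp (measurable_insert_coord i)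
      (measurable_fun_pair measurable_snd measurable_fst)).
  have mG : measurable_fun [set: tupR d.+1]
      (fun y => \int[lebesgue_measure]_t f (insert_coord i t y)).
    exact: (@measurable_fun_fubini_tonelli_F _ _ _ _ _ lebesgue_measure _ mfi).
  have G0 y : 0 <= \int[lebesgue_measure]_t f (insert_coord i t y).
    exact: integral_ge0.
  rewrite (ge0_integral_cons mG G0) fubini_tonelli1//; last first.
    by apply: measurableT_comp mG _; exact: measurable_cons_tup.
  apply: eq_integral => s _; rewrite /fubini_F.
  rewrite (IH j (fun z => f (cons_tup (s, z))))//.
    apply: eq_integral => y _; apply: eq_integral => t _.
    by rewrite ij insert_coordS.
  exact: (measurableT_comp mfc
    (measurable_fun_pair (measurable_cst s) (@measurable_id _ _ setT))).
- exact: tonelli_coord0.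
Qed.

End tonelli.

(** * Volume and bounded sets *)

Section volume.
Context {R : realType}.
Local Notation tupR d := (d.-tuple (measurableTypeR R)).

Definition vol d (A : set 'rV[R]_d) : \bar R :=
  lebesgue_Rd d (@rowvec R d @^-1` A).

Lemma open_open_box d (a b : 'rV[R]_d) : open (open_box a b).
Proof.
have oI i : open [set x : 'rV[R]_d | a 0 i < x 0 i < b 0 i].
  rewrite (_ : [set x | _] = (fun x : 'rV[R]_d => x 0 i) @^-1` `]a 0 i, b 0 i[).
    apply: open_comp; last exact: itv_open.
    by move=> x _; exact: coord_continuous.
  by apply/seteqP; split => x /=; rewrite in_itv.
rewrite (_ : open_box a b = ~` \bigcup_(i in [set: 'I_d])
    ~` [set x : 'rV[R]_d | a 0 i < x 0 i < b 0 i]).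
  apply: closed_openC; apply: closed_bigcup => [|i _]; first exact: finite_finset.
  exact: open_closedC.
by rewrite setC_bigcup; apply/seteqP; split => x /= h i; [move=> _ |];
   have := h i; rewrite ?setCK; [|move/(_ Logic.I)]; rewrite ?setCK.
Qed.

Lemma open_box_insert d (i : 'I_d.+1) (a b : 'rV[R]_d.+1) t (y : tupR d) :
  open_box a b (rowvec (insert_coord i t y)) <->
  a 0 i < t < b 0 i /\ open_box (col' i a) (col' i b) (rowvec y).
Proof.
split => [h|[ht hy] j].
  split; first by have := h i; rewrite mxE tnth_insert_coord.
  by move=> k; have := h (lift i k); rewrite !mxE tnth_insert_coord_lift.
case: (unliftP i j) => [k ->|->]; last by rewrite mxE tnth_insert_coord.
by rewrite mxE tnth_insert_coord_lift; have := hy k; rewrite !mxE.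
Qed.

Lemma vol_open_box d (a b : 'rV[R]_d) : (forall i, a 0 i <= b 0 i) ->
  vol (open_box a b) = (\prod_i (b 0 i - a 0 i))%:E.
Proof.
elim: d a b => [|d IH] a b ab.
  rewrite big_ord0 /vol /= (_ : _ @^-1` _ = setT); first by rewrite diracT.
  by apply/seteqP; split => // t _ [].
have mb := measurable_rowvec_open (@open_open_box d (col' ord0 a) (col' ord0 b)).
transitivity ((lebesgue_measure \x lebesgue_Rd d)%E
  (`]a 0 ord0, b 0 ord0[%classic `*`
   (@rowvec R d @^-1` open_box (col' ord0 a) (col' ord0 b)))).
  rewrite /vol /= /lebesgue_step /pushforward; congr (_ _).
  apply/seteqP; split => -[t y] /=; rewrite -insert_coord0 in_itv /=;
    by move/open_box_insert.
rewrite product_measure1E// -/(vol _) IH; last by move=> i; rewrite !mxE.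
have mI := lebesgue_measure_itv `]a 0 ord0, b 0 ord0[.
rewrite [X in (X * _)%E]mI /= lte_fin big_ord_recl.
under eq_bigr do rewrite !mxE.
have := ab ord0; rewrite le_eqVlt => /predU1P[<-|->]; last by rewrite EFinM.
by rewrite ltxx mul0e subrr mul0r.
Qed.

Lemma ball_open_box d (c : 'rV[R]_d) r : 0 < r ->
  ball c r = open_box (\row_i (c 0 i - r)) (\row_i (c 0 i + r)).
Proof.
move=> r0; apply/seteqP; split => x.
  by move=> /(ball_rowvecP _ _ r0) h i; rewrite !mxE -ltr_distl distrC.
by move=> h; apply/(ball_rowvecP _ _ r0) => i; have := h i;
  rewrite !mxE -ltr_distl distrC.
Qed.

Lemma bounded_open_box d (a b : 'rV[R]_d) : bounded_set (open_box a b).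
Proof.
exists (\sum_j (`|a 0 j| + `|b 0 j|)); split; first exact: num_real.
move=> M hM x xab; rewrite /= [leLHS]/Num.norm /= mx_normrE; apply/bigmax_leP; split.
  by apply: le_trans (ltW hM); apply: sumr_ge0 => j _; rewrite addr_ge0.
move=> [k j] _ /=; rewrite ord1; apply: le_trans (ltW hM).
rewrite (bigD1 j) //= -[leLHS]addr0 lerD //.
  have /andP[/ltW h1 /ltW h2] := xab j.
  rewrite ler_norml; apply/andP; split.
    by rewrite (le_trans _ h1)// lerNl (le_trans (ler_norm _))// normrN lerDl.
  by rewrite (le_trans h2)// (le_trans (ler_norm _))// lerDr.
by apply: sumr_ge0 => k' _; rewrite addr_ge0.
Qed.

Lemma bounded_ball d (c : 'rV[R]_d) r : bounded_set (ball c r).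
Proof.
have [r0|r0] := ltP 0 r; first by rewrite ball_open_box//; exact: bounded_open_box.
exists 0; split; first exact: num_real.
by move=> M _ x [/lt_geF]; rewrite r0.
Qed.

Lemma vol_ball d (c : 'rV[R]_d) r : 0 < r -> vol (ball c r) = ((2 * r) ^+ d)%:E.
Proof.
move=> r0; rewrite ball_open_box// vol_open_box => [|i]; last first.
  by rewrite !mxE lerD2l ge0_cp// ltW.
under eq_bigr => i _.
  rewrite !mxE (_ : _ - _ = 2 * r); last by ring.
  over.
by rewrite prodr_const card_ord.
Qed.

Lemma bounded_sub_ball d (A : set 'rV[R]_d) : bounded_set A ->
  exists2 M : R, 0 < M & A `<=` ball 0 M.
Proof.
move=> /ex_strict_bound_gt0[M M0 h]; exists M => // x /h /=.
by rewrite -ball_normE /= sub0r normrN.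
Qed.

Lemma vol_finite d (A : set 'rV[R]_d) : bounded_set A ->
  measurable (@rowvec R d @^-1` A) -> (vol A < +oo)%E.
Proof.
move=> /bounded_sub_ball[M M0 AM] mA.
apply: (@le_lt_trans _ _ (vol (ball 0 M))); last by rewrite vol_ball// ltry.
apply: le_measure; rewrite ?inE//; last by move=> t; exact: AM.
by apply: measurable_rowvec_open; exact: ball_open.
Qed.

Lemma fin_num_vol d (A : set 'rV[R]_d) : bounded_set A ->
  measurable (@rowvec R d @^-1` A) -> (vol A) \is a fin_num.
Proof. by move=> bA mA; rewrite ge0_fin_numE ?vol_finite. Qed.

Lemma compact_closed_ball d (c : 'rV[R]_d) r : 0 < r ->
  compact (closed_ball c r).
Proof.
move=> r0; apply: bounded_closed_compact; last exact: closed_ball_closed.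
exists (`|c| + r); split; first exact: num_real.
move=> M cM x; rewrite closed_ballE// /closed_ball_ /= => xr.
rewrite (le_trans _ (ltW cM))// -[x](subKr c) (le_trans (ler_normB _ _))//.
by rewrite lerD2l.
Qed.

Lemma continuous_bounded_on d (f : 'rV[R]_d -> R) (A : set 'rV[R]_d) :
  continuous f -> bounded_set A ->
  exists2 M : R, 0 < M & forall x, A x -> `|f x| <= M.
Proof.
move=> cf /bounded_sub_ball[M M0 AM].
have /compact_bounded : compact (f @` closed_ball (0 : 'rV[R]_d) M).
  apply: continuous_compact; last exact: compact_closed_ball.
  exact: continuous_subspaceT.
move=> /ex_strict_bound_gt0[N N0 h]; exists N => // x /AM xM.
by apply/ltW/h; exists x => //; exact: subset_closed_ball.
Qed.

Lemma integrable_continuous d (f : 'rV[R]_d -> R) (A : set 'rV[R]_d) :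
  continuous f -> bounded_set A -> measurable (@rowvec R d @^-1` A) ->
  (lebesgue_Rd d).-integrable (@rowvec R d @^-1` A) (EFin \o (f \o @rowvec R d)).
Proof.
move=> cf bA mA; apply: measurable_bounded_integrable => //.
- exact: vol_finite.
- by apply: measurable_funTS; exact: measurable_fun_rowvec.
- have [M M0 h] := continuous_bounded_on cf bA.
  by exists M; split; [exact: num_real|move=> N MN t /h /le_trans; apply; exact: ltW].
Qed.

End volume.

(** * Integrals of partial derivatives over boxes *)

Section line_derivative.
Context {R : realType} {d : nat}.
Implicit Types (f : 'rV[R]_d -> R) (i : 'I_d).

Lemma line_quotient f i (y : 'rV[R]_d) (t : R) :
  (fun h : R => h^-1 *: (((f \o shift (t *: delta_mx 0 i + y)) : _ -> R)
     (h *: delta_mx 0 i) - f (t *: delta_mx 0 i + y))) =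
  (fun h : R => h^-1 *: (f ((h + t) *: delta_mx 0 i + y)
     - f (t *: delta_mx 0 i + y))).
Proof. by apply/funext => h /=; rewrite scalerDl addrA. Qed.

Lemma is_derive_line f i (y : 'rV[R]_d) (t : R) : (forall x, differentiable f x) ->
  is_derive t 1 (fun s : R => f (s *: delta_mx 0 i + y))
    (partial i f (t *: delta_mx 0 i + y)).
Proof.
move=> df; have dd : derivable f (t *: delta_mx 0 i + y) (delta_mx 0 i).
  exact: diff_derivable.
have dl : derivable (fun s : R => f (s *: delta_mx 0 i + y)) t 1.
  move: dd; rewrite /derivable line_quotient.
  rewrite [X in _ -> cvg (X @ _)](_ : _ = (fun h : R =>
     h^-1 *: (f ((h + t) *: delta_mx 0 i + y)
     - f (t *: delta_mx 0 i + y)))) //.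
  by apply/funext => h; rewrite /= [_%:A]mulr1.
apply: DeriveDef => //; rewrite -derive1E /derive1 /partial /derive.
by rewrite line_quotient.
Qed.

Lemma continuous_line i (y : 'rV[R]_d) :
  continuous (fun s : R => s *: (delta_mx 0 i : 'rV[R]_d) + y).
Proof. by move=> t; apply: cvgD; [exact: cvgZr_tmp|exact: cvg_cst]. Qed.

End line_derivative.

Section box_divergence.
Context {R : realType}.
Local Notation tupR d := (d.-tuple (measurableTypeR R)).

Lemma continuous_differentiable d (f : 'rV[R]_d -> R) :
  (forall x, differentiable f x) -> continuous f.
Proof. by move=> df x; exact: differentiable_continuous. Qed.

(** Integrate first along the coordinate [i]: each line contributes the
    difference of the values of [f] at its end points.  The hypothesis compares
    opposite faces, so that it covers both periodic functions and functions
    that vanish on the faces. *)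
Lemma integral_box_partial d (i : 'I_d) (a b : 'rV[R]_d) (f : 'rV[R]_d -> R) :
  C1 f -> (forall j, a 0 j < b 0 j) ->
  (forall x : 'rV[R]_d, x 0 i = a 0 i ->
    f (x + (b 0 i - a 0 i) *: delta_mx 0 i) = f x) ->
  integral_over (open_box a b) (partial i f) = 0.
Proof.
case: d i a b f => [|d] i a b f; first by case: i.
move=> [df cf] ab fab.
have bB := @bounded_open_box R d.+1 a b.
have mB := measurable_rowvec_open (@open_open_box R d.+1 a b).
(* Tonelli needs nonnegative integrands: add a constant that dominates the
   partial derivative, and compare with the integral of that constant. *)
have [M M0 fM] := continuous_bounded_on (cf i) bB.
pose g1 (t : tupR d.+1) : \bar R := (partial i f (rowvec t) + M)%:E.
pose g2 (t : tupR d.+1) : \bar R := M%:E.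
have ci1 : continuous (fun x => partial i f x + M).
  by move=> x; apply: (@continuousD _ _ _ (partial i f) (fun=> M));
    [exact: cf|exact: cst_continuous].
have mg1 : measurable_fun setT g1.
  by apply/measurable_EFinP; exact: (measurable_fun_rowvec ci1).
have mg2 : measurable_fun setT g2 by exact: measurable_cst.
set B := @rowvec R d.+1 @^-1` open_box a b.
have g1B t : B t -> (0 <= g1 t)%E.
  by move=> /fM; rewrite ler_norml lee_fin => /andP[h _]; rewrite -lerBlDr sub0r.
have inner (y : tupR d) :
    (\int[lebesgue_measure]_t ((g1 \_ B) (insert_coord i t y)) =
     \int[lebesgue_measure]_t ((g2 \_ B) (insert_coord i t y)))%E.
  have [yb|yb] := pselect (open_box (col' i a) (col' i b) (rowvec y)); last first.
    apply: eq_integral => t _; rewrite !patchE memNset//.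
    by move=> /open_box_insert[].
  have sw (g : tupR d.+1 -> \bar R) :
    (\int[lebesgue_measure]_t ((g \_ B) (insert_coord i t y)) =
     \int[lebesgue_measure]_(t in `]a 0%R i, b 0%R i[) g (insert_coord i t y))%E.
    rewrite [RHS]integral_mkcond; apply: eq_integral => t _; rewrite !patchE.
    congr (if _ then _ else _); apply/idP/idP; rewrite !inE /B /= in_itv /=.
      by move=> /open_box_insert[].
    by move=> h; apply/open_box_insert.
  rewrite !sw -[LHS](@integral_itv_bndoo _ _ _ _ true false); last first.
    apply: measurable_funTS.
    exact: (measurableT_comp mg1 (measurable_insert_coordl i y)).
  rewrite -[RHS](@integral_itv_bndoo _ _ _ _ true false); last first.
    exact: measurable_cst.
  set y0 := rowvec (insert_coord i 0 y).
  pose G t := f (t *: delta_mx 0 i + y0) + M * t.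
  have dG (t : R) : is_derive t 1 G (partial i f (t *: delta_mx 0 i + y0) + M).
    apply: is_deriveD; first exact: is_derive_line.
    by have := is_deriveZ M (is_derive_id t 1); rewrite [_%:A]mulr1.
  have cG : continuous G.
    by move=> t; apply: differentiable_continuous; apply/derivable1_diffP.
  under eq_integral do rewrite /g1 rowvec_insert_coord -/y0.
  rewrite (@continuous_FTC2 _ _ G)//; first last.
  - by move=> t _; rewrite derive1E derive_val.
  - split; first by move=> t _.
      by apply: cvg_at_right_filter; exact: cG.
    by apply: cvg_at_left_filter; exact: cG.
  - apply: continuous_subspaceT => t.
    apply: (@continuous_comp _ _ _ (fun s : R => s *: (delta_mx 0 i : 'rV[R]__) + y0)
      (fun x => partial i f x + M)); first exact: continuous_line.
    exact: ci1.
  rewrite integral_cst//= lebesgue_measure_itv/= lte_fin ab -!EFinB -EFinM.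
  congr (_%:E); rewrite /G.
  have := fab (a 0 i *: delta_mx 0 i + y0).
  rewrite mxE /y0 !mxE !eqxx mulr1 tnth_insert_coord addr0 => /(_ erefl).
  rewrite addrAC -scalerDl subrKC => ->; ring.
have E1 : (\int[lebesgue_Rd d.+1]_(t in B) g1 t =
           \int[lebesgue_Rd d.+1]_(t in B) g2 t)%E.
  rewrite [LHS]integral_mkcond [RHS]integral_mkcond !(tonelli_coord i).
  - by apply: eq_integral => y _; exact: inner.
  - exact/(measurable_restrictT _ mB)/measurable_funTS.
  - by apply: erestrict_ge0 => t Bt; rewrite lee_fin ltW.
  - exact/(measurable_restrictT _ mB)/measurable_funTS.
  - exact: erestrict_ge0.
have /(congr1 fine) := E1; rewrite -/(Rintegral _ _ _) -/(Rintegral _ _ _).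
rewrite RintegralD//.
- move=> /eqP; rewrite -subr_eq0 addrK => /eqP; exact.
- exact: (integrable_continuous (cf i) bB mB).
- apply: (integrable_continuous (f := fun=> M) _ bB mB).
  exact: cst_continuous.
Qed.

End box_divergence.

(** * Calculus of continuously differentiable functions *)

Section C1_calculus.
Context {R : realType} {d : nat}.
Implicit Types (f g u : 'rV[R]_d -> R) (i : 'I_d).

Lemma C1_continuous f : C1 f -> continuous f.
Proof. by move=> [df _]; exact: continuous_differentiable. Qed.

Lemma partial_cst i (c : R) : partial i (fun=> c) = fun=> 0.
Proof. by apply/funext => x; rewrite /partial derive_cst. Qed.

Lemma C1_cst (c : R) : C1 (fun _ : 'rV[R]_d => c).
Proof.
split => [x|i]; first exact: differentiable_cst.
by rewrite partial_cst; exact: cst_continuous.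
Qed.

Lemma partialD i f g : C1 f -> C1 g ->
  partial i (fun x => f x + g x) = fun x => partial i f x + partial i g x.
Proof.
move=> [df _] [dg _]; apply/funext => x.
by rewrite /partial (@deriveD _ _ _ f g)//; exact: diff_derivable.
Qed.

Lemma C1D f g : C1 f -> C1 g -> C1 (fun x => f x + g x).
Proof.
move=> hf hg; split => [x|i].
  by apply: (@differentiableD _ _ _ f g); [exact: hf.1|exact: hg.1].
rewrite partialD// => x.
by apply: (@continuousD _ _ _ (partial i f) (partial i g)); [exact: hf.2|exact: hg.2].
Qed.

Lemma partialM i f g : C1 f -> C1 g ->
  partial i (fun x => f x * g x) =
  fun x => f x * partial i g x + g x * partial i f x.
Proof.
move=> [df _] [dg _]; apply/funext => x.
by rewrite /partial (@deriveM _ _ f g)//; exact: diff_derivable.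
Qed.

Lemma C1M f g : C1 f -> C1 g -> C1 (fun x => f x * g x).
Proof.
move=> hf hg; split => [x|i].
  by apply: (@differentiableM _ _ f g); [exact: hf.1|exact: hg.1].
rewrite partialM// => x; apply: (@continuousD _ _ _
  (fun x => f x * partial i g x) (fun x => g x * partial i f x)).
  by apply: (@continuousM _ _ f (partial i g));
    [exact: C1_continuous|exact: hg.2].
by apply: (@continuousM _ _ g (partial i f));
  [exact: C1_continuous|exact: hf.2].
Qed.

Lemma partialZ i (c : R) f : C1 f ->
  partial i (fun x => c * f x) = fun x => c * partial i f x.
Proof.
move=> hf; rewrite (partialM _ (C1_cst c) hf) partial_cst; apply/funext => x.
by rewrite mulr0 addr0.
Qed.

Lemma C1Z (c : R) f : C1 f -> C1 (fun x => c * f x).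
Proof. exact: (C1M (C1_cst c)). Qed.

Lemma partialB i f g : C1 f -> C1 g ->
  partial i (fun x => f x - g x) = fun x => partial i f x - partial i g x.
Proof.
move=> [df _] [dg _]; apply/funext => x.
by rewrite /partial (@deriveB _ _ _ f g)//; exact: diff_derivable.
Qed.

Lemma C1B f g : C1 f -> C1 g -> C1 (fun x => f x - g x).
Proof.
move=> hf hg; rewrite (_ : (fun x => _) = fun x => f x + (-1) * g x).
  exact: C1D hf (C1Z _ hg).
by apply/funext => x; rewrite mulN1r.
Qed.

Lemma partial_coord i j :
  partial i (fun x : 'rV[R]_d => x 0 j) = fun=> (i == j)%:R.
Proof.
apply/funext => x; rewrite /partial.
have := derive_mx (@derivable_id _ _ x (delta_mx 0 i : 'rV[R]_d)).
rewrite derive_id => /matrixP/(_ 0 j); rewrite !mxE eqxx /= eq_sym => ->.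
by [].
Qed.

Lemma C1_coord j : C1 (fun x : 'rV[R]_d => x 0 j).
Proof.
split => [x|i]; first exact: differentiable_coord.
by rewrite partial_coord; exact: cst_continuous.
Qed.

Lemma partial_comp i (h : R -> R) f : (forall t, derivable h t 1) -> C1 f ->
  partial i (h \o f) = fun x => derive1 h (f x) * partial i f x.
Proof.
move=> dh [df _]; apply/funext => x.
have dhf : differentiable h (f x) by apply/derivable1_diffP.
rewrite /partial deriveE; last exact: differentiable_comp.
rewrite diff_comp//= derive1E'// deriveE//.
by rewrite -[X in 'd h (f x) X]mulr1 linearZ /= mulrC.
Qed.

Lemma C1_comp (h : R -> R) f : (forall t, derivable h t 1) ->
  continuous (derive1 h) -> C1 f -> C1 (h \o f).
Proof.
move=> dh ch hf; split => [x|i].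
  by apply: differentiable_comp; [exact: hf.1|apply/derivable1_diffP].
rewrite partial_comp// => x.
apply: (@continuousM _ _ (fun x => derive1 h (f x)) (partial i f)).
  by apply: (@continuous_comp _ _ _ f); [exact: C1_continuous|exact: ch].
exact: hf.2.
Qed.

Lemma partial_sum i n (h : 'I_n -> 'rV[R]_d -> R) : (forall k, C1 (h k)) ->
  partial i (fun x => \sum_k h k x) = fun x => \sum_k partial i (h k) x.
Proof.
move=> hh; apply/funext => x; rewrite /partial -derive_sum//.
  by congr ('D__ _ x); apply/funext => y; rewrite fct_sumE.
by move=> k; apply: diff_derivable; exact: (hh k).1.
Qed.

Lemma C1_sum n (h : 'I_n -> 'rV[R]_d -> R) : (forall k, C1 (h k)) ->
  C1 (fun x => \sum_k h k x).
Proof.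
elim: n h => [|n IH] h hh.
  rewrite (_ : (fun x => _) = fun=> 0); first exact: C1_cst.
  by apply/funext => x; rewrite big_ord0.
rewrite (_ : (fun x => _) = fun x =>
    \sum_k h (widen_ord (leqnSn n) k) x + h ord_max x).
  by apply: C1D => //; exact: IH.
by apply/funext => x; rewrite big_ord_recr.
Qed.

End C1_calculus.

Section cutoff.
Context {R : realType}.

Definition sq_pospart (t : R) := Num.max t 0 ^+ 2.

Lemma is_derive_sq_pospart (t : R) : is_derive t 1 sq_pospart (2 * Num.max t 0).
Proof.
have q : (fun h : R => h^-1 *: ((sq_pospart \o shift t) (h *: 1) - sq_pospart t)) @ 0^' -->
    2 * Num.max t 0.
  apply/cvgrPdist_le => e e0; near=> h.
  have h0 : h != 0 by near: h; exact: nbhs_dnbhs_neq.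
  have he : `|h| <= e.
    near: h; apply: dnbhs0_le => //.
  have hp : `|h * (2 * Num.max t 0) - (sq_pospart (h + t) - sq_pospart t)| <= h ^+ 2.
    rewrite /sq_pospart ler_norml; apply/andP; split.
      by case: (lerP t 0) => ?; case: (lerP (h + t) 0) => ?; nra.
    by case: (lerP t 0) => ?; case: (lerP (h + t) 0) => ?; nra.
  rewrite /= [_%:A]mulr1.
  rewrite (_ : _ - _ = h^-1 * (h * (2 * Num.max t 0) - (sq_pospart (h + t) - sq_pospart t))).
    rewrite normrM normfV ler_pdivrMl ?normr_gt0// (le_trans hp)//.
    by rewrite -real_normK ?num_real// expr2 ler_wpM2l.
  by rewrite mulrBr mulKf.
by apply: DeriveDef; [apply/cvg_ex; eexists; exact: q|exact: cvg_lim q].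
Unshelve. all: by end_near. Qed.

(** A quadratic spline that decreases from 1 at [-1] to 0 at [0]: a second
    difference of the truncated square, hence continuously differentiable. *)
Definition smoothstep (t : R) : R :=
  2 * (sq_pospart (- t) - 2 * sq_pospart (- t - 2^-1) + sq_pospart (- t - 1)).

Lemma smoothstep1 t : t <= -1 -> smoothstep t = 1.
Proof.
move=> t1; rewrite /smoothstep /sq_pospart !max_l; lra.
Qed.

Lemma smoothstep0 t : 0 <= t -> smoothstep t = 0.
Proof. by move=> t1; rewrite /smoothstep /sq_pospart !max_r; lra. Qed.

Lemma smoothstep_itv t : 0 <= smoothstep t <= 1.
Proof.
rewrite /smoothstep /sq_pospart; apply/andP; split.
  by case: (lerP (- t) 0) => ?; case: (lerP (- t - 2^-1) 0) => ?;
  case: (lerP (- t - 1) 0) => ?; nra.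
by case: (lerP (- t) 0) => ?; case: (lerP (- t - 2^-1) 0) => ?;
  case: (lerP (- t - 1) 0) => ?; nra.
Qed.

Definition dsmoothstep (t : R) : R :=
  - 4 * (Num.max (- t) 0 - 2 * Num.max (- t - 2^-1) 0 + Num.max (- t - 1) 0).

Lemma is_derive_smoothstep (t : R) : is_derive t 1 smoothstep (dsmoothstep t).
Proof.
have dm (a : R) : is_derive t 1 (fun s => sq_pospart (- s - a))
    (- (2 * Num.max (- t - a) 0)).
  have da : is_derive t 1 (fun s : R => - s - a) (-1).
    have := is_deriveB (is_deriveN (is_derive_id t 1)) (is_derive_cst a t 1).
    by rewrite subr0.
  have := @is_derive1_comp _ sq_pospart (fun s : R => - s - a) t _ _
    (is_derive_sq_pospart (- t - a)) da.
  by rewrite mulrN1.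
have := is_deriveZ 2 (is_deriveD (is_deriveB (dm 0) (is_deriveZ 2 (dm 2^-1))) (dm 1)).
rewrite (_ : _ *: _ = dsmoothstep t); last first.
  by rewrite /dsmoothstep /GRing.scale /= subr0; ring.
congr (is_derive _ _ _ _); apply/funext => s.
by rewrite /smoothstep -[in sq_pospart (- s)](subr0 (- s)).
Qed.

Lemma dsmoothstep_le t : `|dsmoothstep t| <= 2.
Proof.
rewrite /dsmoothstep ler_norml; apply/andP; split.
by case: (lerP (- t) 0) => ?; case: (lerP (- t - 2^-1) 0) => ?;
  case: (lerP (- t - 1) 0) => ?; lra.
by case: (lerP (- t) 0) => ?; case: (lerP (- t - 2^-1) 0) => ?;
  case: (lerP (- t - 1) 0) => ?; lra.
Qed.

Lemma dsmoothstep_eq0 t : t <= - 1 \/ 0 <= t -> dsmoothstep t = 0.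
Proof.
move=> [] ht; rewrite /dsmoothstep; [rewrite !max_l|rewrite !max_r]; lra.
Qed.

Lemma derivable_smoothstep t : derivable smoothstep t 1.
Proof. by have [] := is_derive_smoothstep t. Qed.

Lemma derive1_smoothstep : derive1 smoothstep = dsmoothstep.
Proof.
apply/funext => t; rewrite derive1E.
by have h := is_derive_smoothstep t; rewrite derive_val.
Qed.

Lemma continuous_dsmoothstep : continuous dsmoothstep.
Proof.
have cm (a : R) : continuous (fun t : R => Num.max (- t - a) 0).
  move=> t; apply: (@continuous_max _ _ (fun t => - t - a) (fun=> 0)).
    by apply: cvgB; [exact: cvgN|exact: cvg_cst].
  exact: cvg_cst.
rewrite (_ : dsmoothstep = fun t => - 4 * (Num.max (- t - 0) 0 -
    2 * Num.max (- t - 2^-1) 0 + Num.max (- t - 1) 0)).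
  move=> t; apply: cvgM; first exact: cvg_cst.
  apply: cvgD; last exact: cm.
  apply: cvgB; first exact: cm.
  by apply: cvgM; [exact: cvg_cst|exact: cm].
by apply/funext => t; rewrite /dsmoothstep subr0.
Qed.

End cutoff.

(** * Plateau functions *)

Section plateau.
Context {R : realType} {d : nat}.
Implicit Types (c x : 'rV[R]_d).

(** Balls for the sup norm are cubes, while the plateau functions below depend
    on the squared Euclidean distance, which is smooth.  A plateau function that is 1
    on a cube therefore only vanishes outside a cube larger by this factor. *)
Definition plateau_radius (n : nat) : R := 2 * n.+1%:R.

Lemma sqnorm2_ball c x r : 0 < r -> ball c r x ->
  sqnorm2 (x - c) <= d.+1%:R * r ^+ 2.
Proof.
move=> r0 /(ball_rowvecP _ _ r0) h.
apply: (@le_trans _ _ (\sum_(i < d) r ^+ 2)).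
  apply: ler_sum => i _; rewrite !mxE -real_normK ?num_real//.
  by rewrite lerXn2r ?nnegrE// 1?ltW// distrC.
rewrite sumr_const card_ord -[leLHS]mulr_natl ler_wpM2r ?sqr_ge0//.
by rewrite ler_nat.
Qed.

Lemma sqnorm2_notin_ball c x r : 0 < r -> ~ ball c (plateau_radius d * r) x ->
  2 * (d.+1%:R * r ^+ 2) <= sqnorm2 (x - c).
Proof.
move=> r0 nb; have d0 : 0 < d.+1%:R :> R by [].
have k0 : 0 < plateau_radius d * r by rewrite !mulr_gt0.
have [i hi] : exists i, plateau_radius d * r <= `|c 0 i - x 0 i|.
  apply: contrapT => /forallNP h; apply: nb; apply/(ball_rowvecP _ _ k0) => i.
  by rewrite ltNge; apply/negP/h.
rewrite /sqnorm2 (bigD1 i)//= -[leLHS]addr0 lerD//; last first.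
  by apply: sumr_ge0 => j _; exact: sqr_ge0.
rewrite !mxE -[leRHS]real_normK ?num_real// distrC.
apply: (@le_trans _ _ ((plateau_radius d * r) ^+ 2)); last first.
  by rewrite lerXn2r ?nnegrE// ltW.
rewrite (mulrA 2 d.+1%:R) [leRHS]exprMn ler_wpM2r ?sqr_ge0// /plateau_radius.
by rewrite exprMn !expr2; have : 1 <= d.+1%:R :> R by [rewrite ler1n]; nra.
Qed.

Lemma C1_sqnorm2 c : C1 (fun x => sqnorm2 (x - c)).
Proof.
apply: C1_sum => k; rewrite (_ : (fun x => _) =
   fun x : 'rV[R]_d => (x 0 k - c 0 k) * (x 0 k - c 0 k)).
  by apply: C1M; apply: C1B; [exact: C1_coord|exact: C1_cst
    |exact: C1_coord|exact: C1_cst].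
by apply/funext => x; rewrite !mxE expr2.
Qed.

Lemma partial_sqnorm2 c i :
  partial i (fun x => sqnorm2 (x - c)) = fun x => 2 * (x 0 i - c 0 i).
Proof.
have hk k : C1 (fun x : 'rV[R]_d => x 0 k - c 0 k).
  by apply: C1B; [exact: C1_coord|exact: C1_cst].
have -> : (fun x => sqnorm2 (x - c)) =
    fun x : 'rV[R]_d => \sum_k (x 0 k - c 0 k) * (x 0 k - c 0 k).
  by apply/funext => x; apply: eq_bigr => k _; rewrite !mxE expr2.
rewrite (@partial_sum _ _ _ _
  (fun k (x : 'rV[R]_d) => (x 0 k - c 0 k) * (x 0 k - c 0 k))); last first.
  by move=> k; exact: C1M.
apply/funext => x; under eq_bigr => k _.
  rewrite partialM// partialB; [|exact: C1_coord|exact: C1_cst].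
  rewrite partial_cst partial_coord subr0; over.
rewrite (bigD1 i)//= big1; last first.
  by move=> k /negbTE ki; rewrite eq_sym ki mulr0 addr0.
by rewrite eqxx /=; ring.
Qed.

Definition plateau c r : 'rV[R]_d -> R :=
  smoothstep \o (fun x => (d.+1%:R * r ^+ 2)^-1 * sqnorm2 (x - c) - 2).

Lemma C1_plateau c r : C1 (plateau c r).
Proof.
apply: C1_comp.
- exact: derivable_smoothstep.
- by rewrite derive1_smoothstep; exact: continuous_dsmoothstep.
- by apply: C1B; [apply/C1Z/C1_sqnorm2|exact: C1_cst].
Qed.

Lemma plateau_itv c r x : 0 <= plateau c r x <= 1.
Proof. exact: smoothstep_itv. Qed.

Lemma plateau1 c r x : 0 < r -> ball c r x -> plateau c r x = 1.
Proof.
move=> r0 /(sqnorm2_ball r0) h; apply: smoothstep1 => /=.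
have : (d.+1%:R * r ^+ 2)^-1 * sqnorm2 (x - c) <= 1.
  by rewrite mulrC ler_pdivrMr ?mul1r// mulr_gt0// exprn_gt0.
set q := _ * sqnorm2 _; lra.
Qed.

Let plateau_arg c r x : 0 < r -> ~ ball c (plateau_radius d * r) x ->
  0 <= (d.+1%:R * r ^+ 2)^-1 * sqnorm2 (x - c) - 2.
Proof.
move=> r0 /(sqnorm2_notin_ball r0) h.
by rewrite subr_ge0 mulrC ler_pdivlMr// mulr_gt0// exprn_gt0.
Qed.

Lemma plateau0 c r x : 0 < r -> ~ ball c (plateau_radius d * r) x -> plateau c r x = 0.
Proof. by move=> r0 h; apply: smoothstep0; exact: plateau_arg. Qed.

Lemma partial_plateau i c r x : partial i (plateau c r) x =
  dsmoothstep ((d.+1%:R * r ^+ 2)^-1 * sqnorm2 (x - c) - 2)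
  * ((d.+1%:R * r ^+ 2)^-1 * (2 * (x 0 i - c 0 i))).
Proof.
have h1 := C1Z (d.+1%:R * r ^+ 2)^-1 (C1_sqnorm2 c).
rewrite partial_comp; [|exact: derivable_smoothstep|]; last first.
  by apply: C1B => //; exact: C1_cst.
rewrite derive1_smoothstep partialB//; last exact: C1_cst.
by rewrite partialZ ?partial_sqnorm2 ?partial_cst ?subr0//; exact: C1_sqnorm2.
Qed.

Lemma partial_plateau0 i c r x : 0 < r -> ~ ball c (plateau_radius d * r) x ->
  partial i (plateau c r) x = 0.
Proof.
move=> r0 h; rewrite partial_plateau dsmoothstep_eq0 ?mul0r//; right.
exact: plateau_arg.
Qed.

(** Together with [partial_plateau0], the scaling that makes a set of small
    (d-1)-dimensional content removable. *)
Lemma partial_plateau_le i c r x : 0 < r -> `|partial i (plateau c r) x| <= 8 / r.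
Proof.
move=> r0.
have [xb|xb] := pselect (ball c (plateau_radius d * r) x); last first.
  by rewrite partial_plateau0// normr0 divr_ge0// ltW.
have d0 : 0 < d.+1%:R :> R by [].
have k0 : 0 < plateau_radius d * r by rewrite !mulr_gt0.
move/(ball_rowvecP _ _ k0)/(_ i) : xb; rewrite distrC => xb.
rewrite partial_plateau normrM.
apply: (@le_trans _ _ (2 * (4 / r))); last by rewrite mulrA -natrM.
rewrite ler_pM//; first exact: dsmoothstep_le.
have D0 : 0 < d.+1%:R * r ^+ 2 by rewrite mulr_gt0// exprn_gt0.
rewrite [leLHS]normrM ger0_norm ?invr_ge0 ?(ltW D0)// normrM (@ger0_norm _ 2)//.
rewrite [leLHS]mulrC ler_pdivrMr//.
apply: (@le_trans _ _ (2 * (plateau_radius d * r))).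
  by rewrite ler_wpM2l// ltW.
by rewrite le_eqVlt; apply/orP; left; apply/eqP; rewrite /plateau_radius; field; lra.
Qed.

End plateau.

(** * Integration over bounded open sets, divergence and flux *)

Lemma continuous_sum_ord {R : realType} (T : topologicalType) n
    (h : 'I_n -> T -> R) : (forall k, continuous (h k)) ->
  continuous (fun x => \sum_k h k x).
Proof.
elim: n h => [|n IH] h ch.
  rewrite (_ : (fun x => _) = fun=> 0); first exact: cst_continuous.
  by apply/funext => x; rewrite big_ord0.
rewrite (_ : (fun x => _) = fun x =>
    \sum_k h (widen_ord (leqnSn n) k) x + h ord_max x).
  by move=> x; apply: cvgD; [apply: IH => k; exact: ch|exact: ch].
by apply/funext => x; rewrite big_ord_recr.
Qed.

Section integral_over.
Context {R : realType} {d : nat}.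
Implicit Types (f g : 'rV[R]_d -> R) (A B O : set 'rV[R]_d).

Lemma integral_over_ext A f g : (forall x, A x -> f x = g x) ->
  integral_over A f = integral_over A g.
Proof. by move=> fg; apply: eq_Rintegral => t; rewrite inE => /fg. Qed.

Lemma integral_over_cover A B f : (forall x, f x != 0 -> A x <-> B x) ->
  integral_over A f = integral_over B f.
Proof.
move=> h; rewrite /integral_over Rintegral_mkcond [RHS]Rintegral_mkcond.
apply: eq_Rintegral => t _; rewrite !patchE.
have [f0|/h hAB] := eqVneq (f (rowvec t)) 0; first by rewrite f0 !if_same.
by congr (if _ then _ else _); apply/idP/idP; rewrite !inE /= => /hAB.
Qed.

Section measurable_domain.
Variables (A : set 'rV[R]_d).
Hypotheses (oA : open A) (bA : bounded_set A).

Let mA : measurable (@rowvec R d @^-1` A) := measurable_rowvec_open oA.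

Lemma integral_overD f g : continuous f -> continuous g ->
  integral_over A (fun x => f x + g x) = integral_over A f + integral_over A g.
Proof.
by move=> cf cg; rewrite /integral_over RintegralD//; exact: integrable_continuous.
Qed.

Lemma integral_overB f g : continuous f -> continuous g ->
  integral_over A (fun x => f x - g x) = integral_over A f - integral_over A g.
Proof.
by move=> cf cg; rewrite /integral_over RintegralB//; exact: integrable_continuous.
Qed.

Lemma integral_overZ (c : R) f : continuous f ->
  integral_over A (fun x => c * f x) = c * integral_over A f.
Proof.
by move=> cf; rewrite /integral_over RintegralZl//; exact: integrable_continuous.
Qed.

Lemma integral_over_sum n (h : 'I_n -> 'rV[R]_d -> R) :
  (forall k, continuous (h k)) ->
  integral_over A (fun x => \sum_k h k x) = \sum_k integral_over A (h k).
Proof.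
elim: n h => [|n IH] h ch.
  rewrite big_ord0 /integral_over.
  by under eq_Rintegral do rewrite big_ord0; rewrite Rintegral_cst ?mul0r.
rewrite big_ord_recr /= -IH// -integral_overD//; last first.
  by apply: continuous_sum_ord => k; exact: ch.
by apply: integral_over_ext => x _; rewrite big_ord_recr.
Qed.

(** The weights and sets are listed to serve both the single slab around a
    smooth boundary piece and the finite cover of the exceptional points. *)
Lemma integral_over_bound f (s : seq (set 'rV[R]_d * R)) : continuous f ->
  (forall p, p \in s -> [/\ open p.1, bounded_set p.1 & 0 <= p.2]) ->
  (forall x, A x -> `|f x| <= \sum_(p <- s) p.2 * \1_(p.1) x) ->
  `|integral_over A f| <= \sum_(p <- s) p.2 * fine (vol p.1).
Proof.
move=> cf hs hf.
have [intg intle] : (lebesgue_Rd d).-integrable (@rowvec R d @^-1` A)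
    (EFin \o (fun t => \sum_(p <- s) p.2 * \1_(p.1) (rowvec t))) /\
    integral_over A (fun x => \sum_(p <- s) p.2 * \1_(p.1) x) <=
    \sum_(p <- s) p.2 * fine (vol p.1).
  elim: s hs {hf} => [|p s IH] hs.
    split; last by rewrite big_nil /integral_over;
      under eq_Rintegral do rewrite big_nil; rewrite Rintegral_cst ?mul0r.
    apply: (eq_integrable _ (fun=> 0%E)) => //; last exact: integrable0.
    by move=> t _ /=; rewrite big_nil.
  have [op bp p0] := hs p (mem_head _ _).
  have mp := measurable_rowvec_open op.
  have [] := IH (fun q qs => hs q (@mem_behead _ (p :: s) q qs)).
  move=> ints les.
  have intp1 : (lebesgue_Rd d).-integrable (@rowvec R d @^-1` A)
      (EFin \o (\1_(@rowvec R d @^-1` p.1))).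
    apply: measurable_bounded_integrable => //; first exact: vol_finite.
    exists 1; split; [exact: num_real|move=> N N1 t _ /=].
    by rewrite indicE; case: (_ \in _); rewrite ?normr1 ?normr0 ltW// (lt_trans _ N1).
  have intp : (lebesgue_Rd d).-integrable (@rowvec R d @^-1` A)
      (EFin \o (fun t => p.2 * \1_(p.1) (rowvec t))).
    have := integrableZl mA p.2 intp1.
    by apply: eq_integrable => // t _ /=; rewrite EFinM !indicE.
  split.
    have := integrableD mA intp ints.
    by apply: eq_integrable => // t _ /=; rewrite big_cons.
  rewrite /integral_over; under eq_Rintegral do rewrite big_cons.
  rewrite RintegralD// big_cons lerD//.
  rewrite (RintegralZl p.2 mA intp1) ler_wpM2l//.
  rewrite /Rintegral integral_indic//=.
  rewrite fine_le ?ge0_fin_numE//; last first.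
  - by apply: le_measure; rewrite ?inE//; exact: measurableI.
  - exact: vol_finite.
  - apply: le_lt_trans (vol_finite bp mp); apply: le_measure; rewrite ?inE//.
    exact: measurableI.
apply: le_trans (intle); apply: le_trans (le_normr_Rintegral mA _) _.
  exact: integrable_continuous.
apply: le_Rintegral => //.
  apply: (integrable_continuous (f := fun x => `|f x|)) => // x.
  by apply: (@continuous_comp _ _ _ f); [exact: cf|exact: norm_continuous].
by move=> t /hf.
Qed.

End measurable_domain.

End integral_over.

Section divergence.
Context {R : realType} {d : nat}.
Implicit Types (Y : 'I_d -> 'rV[R]_d -> R) (f eta : 'rV[R]_d -> R).

Definition divergence Y (x : 'rV[R]_d) : R := \sum_i partial i (Y i) x.

(** Up to the length of [grad eta], the flux density of [Y] through the level
    sets of [eta]; it is what [div (eta * Y)] adds to [eta * div Y]. *)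
Definition flux eta Y (x : 'rV[R]_d) : R := \sum_i partial i eta x * Y i x.

Definition scale_field eta Y : 'I_d -> 'rV[R]_d -> R :=
  fun i x => eta x * Y i x.

Lemma continuous_divergence Y : (forall i, C1 (Y i)) -> continuous (divergence Y).
Proof.
by move=> hY; apply: continuous_sum_ord => i; exact: (hY i).2.
Qed.

Lemma continuous_flux eta Y : C1 eta -> (forall i, C1 (Y i)) ->
  continuous (flux eta Y).
Proof.
move=> he hY; apply: continuous_sum_ord => i x.
by apply: (@continuousM _ _ (partial i eta) (Y i));
  [exact: he.2|exact: C1_continuous].
Qed.

Lemma C1_scale_field eta Y : C1 eta -> (forall i, C1 (Y i)) ->
  forall i, C1 (scale_field eta Y i).
Proof. by move=> he hY i; exact: C1M. Qed.

Lemma divergence_scale eta Y : C1 eta -> (forall i, C1 (Y i)) ->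
  divergence (scale_field eta Y) =
  fun x => eta x * divergence Y x + flux eta Y x.
Proof.
move=> he hY; apply/funext => x; rewrite mulr_sumr -big_split /=.
by apply: eq_bigr => i _; rewrite partialM//= (mulrC (Y i x)).
Qed.

Lemma partial_near0 i f x : (\forall y \near x, f y = 0) -> partial i f x = 0.
Proof.
by move=> f0; rewrite /partial (near_eq_derive (g := cst 0)) ?derive_cst.
Qed.

End divergence.

(** * Volume of slabs around a level set *)

Section slab.
Context {R : realType}.
Local Notation tupR d := (d.-tuple (measurableTypeR R)).

(** By the mean value theorem, [rho] grows at rate at least [c] along every line
    in direction [i], so each such line meets the slab in a set contained in an
    interval of length [2 * e / c]. *)
Lemma vol_slab d (i : 'I_d) (a b : 'rV[R]_d) (rho : 'rV[R]_d -> R) (c : R) :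
  (forall j, a 0 j < b 0 j) -> C1 rho -> 0 < c ->
  (forall x, open_box a b x -> c <= `|partial i rho x|) ->
  exists K : R, forall e : R, 0 < e ->
    (vol (open_box a b `&` [set x | (- e < rho x < 0)%R]) <= (K * e)%:E)%E.
Proof.
case: d i a b rho => [|d] i a b rho; first by case: i.
move=> ab [drho crho] c0 hc.
set a' := col' i a; set b' := col' i b.
have ab' j : a' 0 j <= b' 0 j by rewrite !mxE ltW.
exists (2 / c * \prod_j (b' 0 j - a' 0 j)) => e e0.
set A := _ `&` _.
have oA : open A.
  apply: openI; first exact: open_open_box.
  rewrite (_ : [set x | _] = rho @^-1` `]- e, 0[).
    apply: open_comp; last exact: itv_open.
    by move=> x _; exact: continuous_differentiable.
  by apply/seteqP; split => x /=; rewrite in_itv.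
have mA := measurable_rowvec_open oA.
have mB := measurable_rowvec_open (@open_open_box R d a' b').
pose B := @rowvec R d @^-1` open_box a' b'.
have mind : measurable_fun [set: tupR d.+1]
    (fun x => (\1_(@rowvec R d.+1 @^-1` A) x)%:E : \bar R).
  by apply/measurable_EFinP; exact: measurable_indic.
rewrite /vol -[X in (X <= _)%E](_ : (\int[lebesgue_Rd d.+1]_x
    (\1_(@rowvec R d.+1 @^-1` A) x)%:E = _)%E); last first.
  by rewrite integral_indic// setIT.
rewrite (tonelli_coord i)//.
have slice (y : tupR d) : (\int[lebesgue_measure]_t
    (\1_(@rowvec R d.+1 @^-1` A) (insert_coord i t y))%:E <=
    (2 / c * e)%:E * (\1_B y)%:E)%E.
  have [[t0 At0]|nA] := pselect (exists t0, A (rowvec (insert_coord i t0 y)));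
      last first.
    rewrite integral0_eq ?mule_ge0 ?lee_fin//.
      by rewrite mulr_ge0 ?divr_ge0 ?(ltW c0) ?(ltW e0).
    move=> t _; rewrite indicE memNset// => At.
    by apply: nA; exists t.
  have [/open_box_insert[t0ab yB] /= rho0] := At0.
  rewrite indicE mem_set// mule1.
  apply: (@le_trans _ _ (\int[lebesgue_measure]_t
      (\1_(`[t0 - e / c, t0 + e / c]%classic) t)%:E)%E); last first.
    have mI := lebesgue_measure_itv `[t0 - e / c, t0 + e / c].
    rewrite integral_indic// setIT [X in (X <= _)%E]mI /= lte_fin.
    rewrite ltrD2l gtrN ?divr_gt0// lee_fin.
    by rewrite le_eqVlt; apply/orP; left; apply/eqP; ring.
  apply: ge0_le_integral => //.
  - exact: (measurableT_comp mind (measurable_insert_coordl i y)).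
  - by apply/measurable_EFinP; exact: measurable_indic.
  move=> t _; rewrite lee_fin !indicE.
  have [/= At|At] := pselect (A (rowvec (insert_coord i t y))); last first.
    by rewrite memNset.
  rewrite !mem_set//= in_itv /= -ler_distl.
  have [/open_box_insert[tab _] /= rho1] := At.
  rewrite ler_pdivlMr//.
  set y0 := rowvec (insert_coord i 0 y).
  have lip s1 s2 : s1 < s2 -> a 0 i < s1 -> s2 < b 0 i ->
      `|s2 - s1| * c <= `|rho (s2 *: delta_mx 0 i + y0) -
                          rho (s1 *: delta_mx 0 i + y0)|.
    move=> s12 as1 s2b.
    have [] := @MVT _ (fun s : R => rho (s *: delta_mx 0 i + y0)) (fun s : R =>
        partial i rho (s *: delta_mx 0 i + y0)) s1 s2 s12.
    - by move=> s _; exact: is_derive_line.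
    - apply: continuous_subspaceT => s.
      apply: (@continuous_comp _ _ _ 
        (fun s : R => s *: (delta_mx 0 i : 'rV[R]_d.+1) + y0) rho).
        exact: continuous_line.
      exact: continuous_differentiable.
    move=> s; rewrite in_itv /= => /andP[s1s ss2] ->.
    rewrite normrM mulrC ler_wpM2r// /y0 -rowvec_insert_coord; apply: hc.
    apply/open_box_insert; split => //.
    by rewrite (lt_trans as1)// (lt_trans ss2).
  have hr : `|rho (rowvec (insert_coord i t y)) -
      rho (rowvec (insert_coord i t0 y))| <= e.
    by rewrite ler_norml; apply/andP; split; lra.
  move: hr; rewrite (rowvec_insert_coord i t) (rowvec_insert_coord i t0) -/y0 => hr.
  move/andP: tab => [ta tb]; move/andP: t0ab => [t0a t0b].
  apply: le_trans hr; have [t0t|tt0|->] := ltgtP t0 t.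
  - by rewrite lip.
  - by rewrite distrC [leRHS]distrC lip.
  - by rewrite !subrr !normr0 mul0r.
apply: (@le_trans _ _ (\int[lebesgue_Rd d]_y ((2 / c * e)%:E * (\1_B y)%:E))%E).
  apply: ge0_le_integral => //.
  - by move=> y _; apply: integral_ge0 => t _.
  - have mfi : measurable_fun [set: tupR d * measurableTypeR R]
      (fun p => (\1_(@rowvec R d.+1 @^-1` A) (insert_coord i p.2 p.1))%:E : \bar R).
      exact: (measurableT_comp mind (measurableT_comp
        (measurable_insert_coord i)
        (measurable_fun_pair measurable_snd measurable_fst))).
    exact: (@measurable_fun_fubini_tonelli_F _ _ _ _ _ lebesgue_measure _ mfi).
  - apply: measurable_funeM; apply/measurable_EFinP; exact: measurable_indic.
have ce0 : 0 <= 2 / c * e by rewrite mulr_ge0 ?divr_ge0 ?(ltW c0) ?(ltW e0).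
rewrite ge0_integralZl//; last first.
- by apply/measurable_EFinP; exact: measurable_indic.
rewrite integral_indic// setIT [X in (_ * X)%E](vol_open_box ab') -EFinM lee_fin.
by rewrite le_eqVlt; apply/orP; left; apply/eqP; ring.
Qed.

End slab.

(** * The divergence theorem near a point *)

Section local_divergence.
Context {R : realType} {d : nat}.
Implicit Types (Y : 'I_d -> 'rV[R]_d -> R) (p : 'rV[R]_d).

Lemma bounded_subset (A B : set 'rV[R]_d) :
  A `<=` B -> bounded_set B -> bounded_set A.
Proof.
move=> AB [M [Mr hM]]; exists M; split => // N MN x /AB; exact: hM.
Qed.

Lemma divergence_support Y p s : 0 < s ->
  (forall i x, ~ ball p s x -> Y i x = 0) ->
  forall x, ~ closed_ball p s x -> divergence Y x = 0.
Proof.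
move=> s0 Y0 x nx; rewrite /divergence big1// => i _; apply: partial_near0.
have oC : open (~` closed_ball p s) by apply: closed_openC; exact: closed_ball_closed.
have := open_nbhs_nbhs (conj oC nx); apply: filterS => y ny.
by apply: Y0 => /subset_closed_ball.
Qed.

Lemma closed_ball_sub_ball p (s s' : R) : 0 < s -> s < s' ->
  closed_ball p s `<=` ball p s'.
Proof.
move=> s0 ss' x; rewrite closed_ballE// /closed_ball_ /= => h.
by rewrite -ball_normE /=; exact: le_lt_trans ss'.
Qed.

Lemma integral_divergence_ball Y p s : 0 < s -> (forall i, C1 (Y i)) ->
  (forall i x, ~ ball p s x -> Y i x = 0) ->
  integral_over (ball p s) (divergence Y) = 0.
Proof.
move=> s0 hY Y0; rewrite integral_over_sum; last 3 first.
- exact: ball_open.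
- exact: bounded_ball.
- by move=> i; exact: (hY i).2.
rewrite big1// => i _; rewrite ball_open_box//.
apply: integral_box_partial => //.
  by move=> j; rewrite !mxE; lra.
move=> x; rewrite !mxE => xi.
have nb (y : 'rV[R]_d) : `|p 0 i - y 0 i| = s -> ~ ball p s y.
  by move=> ys /(ball_rowvecP _ _ s0)/(_ i); rewrite ys ltxx.
rewrite !Y0//; apply: nb.
  by rewrite xi subKr gtr0_norm.
rewrite !mxE xi !eqxx mulr1 (_ : p 0 i - _ = - s); last by ring.
by rewrite normrN gtr0_norm.
Qed.

Lemma integral_divergence_interior Y (Om : set 'rV[R]_d) p s s' :
  0 < s -> s < s' -> (forall i, C1 (Y i)) -> ball p s' `<=` Om ->
  (forall i x, ~ ball p s x -> Y i x = 0) ->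
  integral_over Om (divergence Y) = 0.
Proof.
move=> s0 ss' hY pOm Y0.
rewrite -(@integral_divergence_ball Y p s')//; last 2 first.
- exact: lt_trans ss'.
- by move=> i x nx; apply: Y0 => /(le_ball (ltW ss')).
apply: integral_over_cover => x Yx.
have : ball p s' x; last by split => // _; exact: pOm.
apply: contrapT => nx; move/eqP: Yx; apply.
apply: (divergence_support s0 Y0) => xs; apply: nx.
exact: closed_ball_sub_ball xs.
Qed.

(** Where [`|g|] is at least [e], the function [`|rho|] is positive; on a compact
    set it then has a positive minimum. *)
Lemma small_near_zero_set (g rho : 'rV[R]_d -> R) (K : set 'rV[R]_d) (e : R) :
  compact K -> continuous g -> continuous rho ->
  (forall x, K x -> rho x = 0 -> g x = 0) -> 0 < e ->
  exists2 m : R, 0 < m & forall x, K x -> `|rho x| < m -> `|g x| < e.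
Proof.
move=> cK cg crho K0 e0.
pose K' := K `&` [set x | e <= `|g x|].
have cK' : compact K'.
  apply: compact_closedI => //.
  rewrite (_ : [set x | _] = (fun x => `|g x|) @^-1` [set y | e <= y]).
    apply: closed_comp; last exact: closed_ge.
    move=> x _.
    by apply: (@continuous_comp _ _ _ g); [exact: cg|exact: norm_continuous].
  by [].
have [[x0 K'x0]|K'0] := pselect (K' !=set0); last first.
  exists 1 => // x Kx _; rewrite ltNge; apply/negP => egx.
  by apply: K'0; exists x.
have cr : {within K', continuous (fun x => `|rho x|)}.
  apply: continuous_subspaceT => x.
  by apply: (@continuous_comp _ _ _ rho); [exact: crho|exact: norm_continuous].
have [|c /set_mem[Kc ec] hc] := EVT_min_rV _ cK' cr; first by exists x0.
exists `|rho c|.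
  rewrite normr_gt0; apply/eqP => /(K0 _ Kc) gc.
  by move: ec; rewrite /= gc normr0 leNgt e0.
move=> x Kx; rewrite !ltNge; apply: contra => egx.
by apply: hc; rewrite inE.
Qed.

(** Multiplying [Y] by a smooth step of [rho / del] replaces the sharp boundary
    of [Om] by a compactly supported field, whose divergence integrates to
    zero.  The difference is supported in the slab [- del < rho < 0] of volume
    [K * del]; there it is bounded by [M + 2 * e / del], because the flux of
    [Y] through the level sets of [rho] tends to zero at the boundary. *)
Lemma integral_divergence_boundary Y (Om : set 'rV[R]_d) p s s'
    (rho : 'rV[R]_d -> R) (i : 'I_d) (c : R) :
  0 < s -> s < s' -> (forall i, C1 (Y i)) -> C1 rho -> 0 < c ->
  (forall x, closed_ball p s' x -> Om x <-> rho x < 0) ->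
  (forall x, closed_ball p s' x -> c <= `|partial i rho x|) ->
  (forall x, closed_ball p s' x -> rho x = 0 -> flux rho Y x = 0) ->
  (forall i x, ~ ball p s x -> Y i x = 0) ->
  integral_over Om (divergence Y) = 0.
Proof.
move=> s0 ss' hY hrho c0 hOm hpar hflux Y0.
have s'0 : 0 < s' by exact: lt_trans ss'.
set U := ball p s'.
have UK : U `<=` closed_ball p s' by exact: subset_closed_ball.
have crho := C1_continuous hrho.
pose D := U `&` [set x | rho x < 0].
have oD : open D.
  apply: openI; first exact: ball_open.
  rewrite (_ : [set x | _] = rho @^-1` [set y | y < 0])//.
  by apply: open_comp; [move=> x _; exact: crho|exact: open_lt].
have bU : bounded_set U by exact: bounded_ball.
have bD : bounded_set D by apply: bounded_subset bU => x [].
have -> : integral_over Om (divergence Y) = integral_over D (divergence Y).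
  apply: integral_over_cover => x Yx.
  have Ux : U x.
    apply: contrapT => nx; move/eqP: Yx; apply.
    apply: (divergence_support s0 Y0) => xs; apply: nx.
    exact: closed_ball_sub_ball xs.
  by split => [/(hOm _ (UK _ Ux))|[_ /(hOm _ (UK _ Ux))]].
have cdiv := continuous_divergence hY.
have [M M0 hM] := continuous_bounded_on cdiv bU.
have [K hK] : exists K : R, forall e : R, 0 < e ->
    (vol (U `&` [set x | (- e < rho x < 0)%R]) <= (K * e)%:E)%E.
  rewrite /U ball_open_box//; apply: (vol_slab (c := c) (i := i)) => //.
    by move=> j; rewrite !mxE; lra.
  by rewrite -ball_open_box// => x /UK; exact: hpar.
have K0 : 0 <= K.
  have := hK 1 ltr01; rewrite mulr1 -lee_fin; apply: le_trans.
  exact: measure_ge0.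
have main e : 0 < e -> `|integral_over D (divergence Y)| <= K * (M + 2) * e.
  move=> e0.
  have [m m0 hm] := small_near_zero_set (@compact_closed_ball R d p s' s'0)
    (continuous_flux hrho hY) crho hflux e0.
  pose del := Num.min m e.
  have del0 : 0 < del by rewrite lt_min m0 e0.
  pose h := smoothstep \o (fun x => del^-1 * rho x).
  have hC : C1 h.
    apply: C1_comp; [exact: derivable_smoothstep| |exact: C1Z].
    by rewrite derive1_smoothstep; exact: continuous_dsmoothstep.
  have fluxh x : flux h Y x = dsmoothstep (del^-1 * rho x) * (del^-1 * flux rho Y x).
    rewrite /flux !mulr_sumr; apply: eq_bigr => k _.
    rewrite /h partial_comp; [|exact: derivable_smoothstep|exact: C1Z].
    by rewrite derive1_smoothstep partialZ// !mulrA.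
  have hYC := C1_scale_field hC hY.
  have chYC := continuous_divergence hYC.
  have int0 : integral_over D (divergence (scale_field h Y)) = 0.
    rewrite -(@integral_divergence_ball (scale_field h Y) p s')//; last first.
      move=> k x nx; rewrite /scale_field Y0 ?mulr0// => xs; apply: nx.
      exact: le_ball (ltW ss') _ xs.
    apply: integral_over_cover => x Yx; split => [[]//|Ux]; split => //=.
    rewrite ltNge; apply: contra Yx => rho0.
    have a0 : 0 <= del^-1 * rho x by rewrite mulr_ge0// invr_ge0 ltW.
    rewrite divergence_scale// fluxh dsmoothstep_eq0; last by right.
    by rewrite /h /= smoothstep0// !mul0r addr0.
  rewrite -[integral_over D _]subr0 -int0 -integral_overB//.
  set A := U `&` [set x | (- del < rho x < 0)%R].
  have oA : open A.
    apply: openI; first exact: ball_open.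
    rewrite (_ : [set x | _] = rho @^-1` `]- del, 0[).
      by apply: open_comp; [move=> x _; exact: crho|exact: itv_open].
    by apply/seteqP; split => x /=; rewrite in_itv.
  have bA : bounded_set A by apply: bounded_subset bU => x [].
  pose N := M + 2 * (del^-1 * e).
  have N0 : 0 <= N by rewrite addr_ge0 ?mulr_ge0 ?invr_ge0 ?ltW.
  apply: (@le_trans _ _ (\sum_(q <- [:: (A, N)]) q.2 * fine (vol q.1))).
    apply: integral_over_bound => //.
    - move=> x; apply: (@continuousB _ _ _ (divergence Y)
        (divergence (scale_field h Y))); [exact: cdiv|exact: chYC].
    - by move=> q; rewrite inE => /eqP ->.
    move=> x [Ux /= rx0]; rewrite big_seq1 /= divergence_scale// fluxh indicE.
    have [rx|rx] := ltP (- del) (rho x); last first.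
      have a1 : del^-1 * rho x <= -1.
        by rewrite mulrC ler_pdivrMr// mulN1r.
      rewrite dsmoothstep_eq0; last by left.
      rewrite /h /= smoothstep1// mul0r addr0 mul1r subrr normr0.
      by rewrite mulr_ge0.
    rewrite mem_set; last by split => //=; rewrite rx rx0.
    rewrite mulr1 opprD addrA -[X in X - _ - _]mul1r -mulrBl.
    rewrite (le_trans (ler_normB _ _))// /N lerD//.
      rewrite normrM -[leRHS]mul1r ler_pM//; last exact: hM.
      have /andP[h0 h1] := smoothstep_itv (del^-1 * rho x).
      by rewrite /h /= ger0_norm ?subr_ge0// lerBlDr lerDl.
    rewrite normrM ler_pM//; first exact: dsmoothstep_le.
    rewrite normrM ger0_norm ?invr_ge0 ?(ltW del0)// ler_wpM2l ?invr_ge0 ?(ltW del0)//.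
    apply/ltW/hm; first exact: UK.
    rewrite ltr0_norm// ltrNl (le_lt_trans _ rx)// lerN2 /del.
    by rewrite ge_min lexx.
  rewrite big_seq1 /=.
  have volA : fine (vol A) <= K * del.
    rewrite -lee_fin fineK; first exact: hK.
    exact: fin_num_vol bA (measurable_rowvec_open oA).
  apply: (@le_trans _ _ (N * (K * del))); first by rewrite ler_wpM2l.
  have -> : N * (K * del) = K * (M * del + 2 * e).
    by rewrite /N; field; exact: lt0r_neq0.
  have dele : del <= e by rewrite /del ge_min lexx orbT.
  rewrite -mulrA ler_wpM2l//.
  by have := ler_wpM2l (ltW M0) dele; lra.
apply/eqP; rewrite -normr_le0; apply/ler_addgt0Pr => e e0; rewrite add0r.
have KM : 0 < K * (M + 2) + 1 by rewrite ltr_wpDl// mulr_ge0// addr_ge0// ltW.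
apply: le_trans (main (e / (K * (M + 2) + 1)) (divr_gt0 e0 KM)) _.
by rewrite mulrA ler_pdivrMr// mulrC ler_wpM2l ?(ltW e0)// lerDl.
Qed.

End local_divergence.

(** * The divergence theorem for tangential fields *)

Section divergence_theorem.
Context {R : realType} {d : nat}.
Implicit Types (Y X : 'I_d -> 'rV[R]_d -> R) (p n : 'rV[R]_d)
  (Om : set 'rV[R]_d).

Definition tangential Om Y : Prop :=
  forall p n, outward_unit_normal Om p n -> \sum_i n 0 i * Y i p = 0.

(** The divergence theorem for fields supported near [p]; the global theorem
    patches this local property together. *)
Definition null_divergence Om p (s : R) : Prop :=
  forall Y, (forall i, C1 (Y i)) -> tangential Om Y ->
    (forall i x, ~ ball p s x -> Y i x = 0) ->
    integral_over Om (divergence Y) = 0.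

Lemma tangential_scale Om (eta : 'rV[R]_d -> R) Y :
  tangential Om Y -> tangential Om (scale_field eta Y).
Proof.
move=> tY p n hn; rewrite /scale_field.
under eq_bigr do rewrite mulrCA.
by rewrite -mulr_sumr tY// mulr0.
Qed.

Lemma sqnorm2_gt0 (v : 'rV[R]_d) : v != 0 -> 0 < sqnorm2 v.
Proof.
move=> v0; rewrite lt_neqAle sumr_ge0 ?andbT; last first.
  by move=> i _; exact: sqr_ge0.
rewrite eq_sym; apply: contra v0 => /eqP/psumr_eq0P h.
apply/eqP/rowP => i; rewrite mxE; apply/eqP.
by rewrite -sqrf_eq0 h// => j _; exact: sqr_ge0.
Qed.

(** At a boundary point the defining function [rho] given there also defines the
    normal at all nearby boundary points, so tangency of [Y] yields
    [flux rho Y = 0] on the whole zero set of [rho] near [p]. *)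
Lemma null_divergence_exists Om p : open Om -> closure Om p ->
  ~ singular_boundary Om p -> exists2 s : R, 0 < s & null_divergence Om p s.
Proof.
move=> oOm cp nsing.
have [Op|nOp] := pselect (Om p).
  have /nbhs_ballP[s' /= s'0 hs'] := open_nbhs_nbhs (conj oOm Op).
  exists (s' / 2); first by rewrite divr_gt0.
  move=> Y hY _ Y0; apply: (@integral_divergence_interior _ _ _ _ p (s' / 2) s') => //.
  - by rewrite divr_gt0.
  - by rewrite ltr_pdivrMr// mulr_natr mulr2n ltrDl.
have [n [rho [hrho rhop gp hOm _]]] : exists n, outward_unit_normal Om p n.
  apply: contrapT => hn; apply: nsing; split => //; split => //.
  by move=> /interior_subset.
have [i pi0] : exists i, partial i rho p != 0.
  apply: contrapT => /forallNP h; move/eqP: gp; apply.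
  by apply/rowP => i; rewrite !mxE; apply/eqP; have /negP := h i; rewrite negbK.
pose c := `|partial i rho p| / 2.
have c0 : 0 < c by rewrite divr_gt0// normr_gt0.
have hpar : \forall x \near p, c <= `|partial i rho x|.
  have cn : {for p, continuous (fun x => `|partial i rho x|)}.
    by apply: (@continuous_comp _ _ _ (partial i rho));
      [exact: hrho.2|exact: norm_continuous].
  have cp' : c < `|partial i rho p|.
    by rewrite ltr_pdivrMr// mulr_natr mulr2n ltrDl normr_gt0.
  by near=> x; apply/ltW; near: x; exact: (cvgr_gt _ cn _ cp').
have /nbhs_ballP[e /= e0 he] : nbhs p
    [set x | (Om x <-> rho x < 0) /\ c <= `|partial i rho x|].
  exact: filterI.
have e2 : 0 < e / 2 by rewrite divr_gt0.
have e4 : 0 < e / 4 by rewrite divr_gt0.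
have K_ball : closed_ball p (e / 2) `<=` ball p e.
  have e2e : e / 2 < e by lra.
  exact: (closed_ball_sub_ball e2 e2e).
exists (e / 4) => //.
move=> Y hY tY Y0; apply: (@integral_divergence_boundary _ _ _ _ p (e / 4) (e / 2)
  rho i c) => //.
- lra.
- by move=> x /K_ball/he[].
- by move=> x /K_ball/he[].
move=> x Kx rx.
have gx : grad rho x != 0.
  apply/eqP => /rowP/(_ i); rewrite !mxE => gx.
  by have [_] := he _ (K_ball _ Kx); rewrite gx normr0 leNgt c0.
have N0 : Num.sqrt (sqnorm2 (grad rho x)) != 0.
  by rewrite gt_eqF// sqrtr_gt0 sqnorm2_gt0.
have /tY : outward_unit_normal Om x
    ((Num.sqrt (sqnorm2 (grad rho x)))^-1 *: grad rho x).
  exists rho; split => //.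
  have := open_nbhs_nbhs (conj (ball_open p e) (K_ball _ Kx)).
  by apply: filterS => y /he[].
under eq_bigr do rewrite !mxE -mulrA.
rewrite -mulr_sumr => /eqP; rewrite mulf_eq0 invr_eq0 (negbTE N0) /=.
by move/eqP.
Unshelve. all: by end_near. Qed.

Lemma divergence_eq0_on Om Y : open Om -> (forall i x, Om x -> Y i x = 0) ->
  forall x, Om x -> divergence Y x = 0.
Proof.
move=> oOm Y0 x Ox; rewrite /divergence big1// => i _; apply: partial_near0.
by have := open_nbhs_nbhs (conj oOm Ox); apply: filterS => y; exact: Y0.
Qed.

Lemma divergence_split (b : 'rV[R]_d -> R) Y : C1 b -> (forall i, C1 (Y i)) ->
  divergence Y = fun x => divergence (scale_field b Y) x +
    divergence (scale_field (fun x => 1 - b x) Y) x.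
Proof.
move=> hb hY.
have h1b : C1 (fun x => 1 - b x) by apply: C1B => //; exact: C1_cst.
apply/funext => x; rewrite !divergence_scale//.
have -> : flux (fun x => 1 - b x) Y x = - flux b Y x.
  rewrite /flux -sumrN; apply: eq_bigr => i _.
  by rewrite partialB//; [rewrite partial_cst sub0r mulNr|exact: C1_cst].
ring.
Qed.

(** A partition of unity unrolled into an induction: with [b] the plateau
    function of the first ball, [b * Y] is supported near its centre, and
    [(1 - b) * Y] vanishes outside the remaining balls. *)
Lemma integral_divergence_cover Om (L : seq ('rV[R]_d * R)) Y :
  open Om -> bounded_set Om ->
  (forall q, q \in L -> 0 < q.2 /\ null_divergence Om q.1 (plateau_radius d * q.2)) ->
  (forall i, C1 (Y i)) -> tangential Om Y ->
  (forall x, Om x -> (forall q, q \in L -> ~ ball q.1 q.2 x) ->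
    forall i, Y i x = 0) ->
  integral_over Om (divergence Y) = 0.
Proof.
move=> oOm bOm; elim: L Y => [|[p r] L IH] Y hL hY tY Y0.
  rewrite (@integral_over_ext _ _ _ _ (fun=> 0)).
    by rewrite /integral_over Rintegral_cst ?mul0r//; exact: measurable_rowvec_open.
  by apply: divergence_eq0_on => // i x Ox; exact: Y0.
have [/= r0 good] := hL _ (mem_head _ _).
have hb := C1_plateau p r.
have h1b : C1 (fun x => 1 - plateau p r x) by apply: C1B => //; exact: C1_cst.
rewrite (divergence_split hb hY) integral_overD//; last 2 first.
- by apply: continuous_divergence; exact: C1_scale_field.
- by apply: continuous_divergence; exact: C1_scale_field.
rewrite good; last 3 first.
- exact: C1_scale_field.
- exact: tangential_scale.
- by move=> i x nx; rewrite /scale_field plateau0// mul0r.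
rewrite add0r; apply: IH.
- by move=> q qL; apply: hL; rewrite inE qL orbT.
- exact: C1_scale_field.
- exact: tangential_scale.
move=> x Ox hx i; rewrite /scale_field.
have [xp|xp] := pselect (ball p r x); first by rewrite plateau1// subrr mul0r.
by rewrite Y0 ?mulr0// => q; rewrite inE => /predU1P[->//|]; exact: hx.
Qed.

(** The product of the functions [1 - plateau] over all balls.  The factor
    [8 / q.2] is the gradient bound of a plateau function; radii at most 1 make
    it also dominate the plateau function itself, so that a single sum bounds
    the loss of mass and the gradient. *)
Lemma cutoff_balls (s : seq ('rV[R]_d * R)) :
  (forall q, q \in s -> 0 < q.2 <= 1) ->
  exists chi : 'rV[R]_d -> R, [/\ C1 chi, forall x, 0 <= chi x <= 1,
    forall q x, q \in s -> ball q.1 q.2 x -> chi x = 0,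
    forall x, 1 - chi x <=
      \sum_(q <- s) 8 / q.2 * \1_(ball q.1 (plateau_radius d * q.2)) x &
    forall i x, `|partial i chi x| <=
      \sum_(q <- s) 8 / q.2 * \1_(ball q.1 (plateau_radius d * q.2)) x].
Proof.
elim: s => [|[p r] s IH] hs.
  exists (fun=> 1); split => //.
  - exact: C1_cst.
  - by move=> x; rewrite ler01 lexx.
  - by move=> x; rewrite big_nil subrr.
  - by move=> i x; rewrite big_nil partial_cst normr0.
have [q qs|chi [hchi chi01 chi0 chi1 dchi]] := IH.
  by apply: hs; rewrite inE qs orbT.
have /andP[/= r0 r1] := hs _ (mem_head _ _).
have hb := C1_plateau p r.
have h1b : C1 (fun x => 1 - plateau p r x) by apply: C1B => //; exact: C1_cst.
have k8 : 1 <= 8 / r by rewrite ler_pdivlMr// mul1r (le_trans r1)// ler1n.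
exists (fun x => chi x * (1 - plateau p r x)); split.
- exact: C1M.
- move=> x; have /andP[? ?] := chi01 x; have /andP[? ?] := plateau_itv p r x.
  by apply/andP; split; nra.
- move=> q x; rewrite inE => /predU1P[->/= xp|qs /(chi0 _ _ qs) ->].
    by rewrite plateau1// subrr mulr0.
  by rewrite mul0r.
- move=> x; rewrite big_cons /=.
  have hb1 : plateau p r x <= 8 / r * \1_(ball p (plateau_radius d * r)) x.
    rewrite indicE; have [xp|xp] := pselect (ball p (plateau_radius d * r) x).
      rewrite mem_set// mulr1 (le_trans _ k8)//.
      by have /andP[] := plateau_itv p r x.
    by rewrite plateau0// memNset// mulr0.
  have := chi1 x; have /andP[? ?] := chi01 x; have /andP[? ?] := plateau_itv p r x.
  nra.
- move=> i x; rewrite big_cons /= partialM// partialB//; last exact: C1_cst.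
  rewrite partial_cst sub0r (le_trans (ler_normD _ _))// lerD//.
    rewrite normrM normrN (le_trans (y := `|partial i (plateau p r) x|))//.
      have /andP[c0 c1] := chi01 x.
      by rewrite ger0_norm// -[leRHS]mul1r ler_wpM2r.
    rewrite indicE; have [xp|xp] := pselect (ball p (plateau_radius d * r) x).
      by rewrite mem_set// mulr1 partial_plateau_le.
    by rewrite partial_plateau0// normr0 memNset// mulr0.
  rewrite normrM -[leRHS]mul1r ler_pM//.
  have /andP[b0 b1] := plateau_itv p r x.
  by rewrite ger0_norm ?subr_ge0// lerBlDr lerDl.
Qed.

Lemma bounded_closure Om : bounded_set Om -> bounded_set (closure Om).
Proof.
move=> /bounded_sub_ball[M M0 OM].
apply: (@bounded_subset _ _ _ (ball 0 (M + 1))); last exact: bounded_ball.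
apply: (@subset_trans _ (closed_ball 0 M)); last first.
  have MM : M < M + 1 by rewrite ltrDl.
  exact: (closed_ball_sub_ball M0 MM).
have /closure_id -> : closed (closed_ball (0 : 'rV[R]_d) M) by exact: closed_ball_closed.
by apply: closure_subset; apply: subset_trans OM _; exact: subset_closed_ball.
Qed.

(** Cut [X] off near the exceptional boundary points; what remains is covered by
    finitely many good balls, and the error tends to zero with the surface
    content of the exceptional points. *)
Theorem divergence_theorem Om X : (1 < d)%N -> piecewise_C1_domain Om ->
  (forall i, C1 (X i)) -> tangential Om X ->
  integral_over Om (divergence X) = 0.
Proof.
move=> d1 [oOm _ _ bOm nullS] hX tX.
have cdiv := continuous_divergence hX.
have [M0 M00 hM0] := continuous_bounded_on cdiv bOm.
have [M1 M10 hM1] : exists2 M1 : R, 0 < M1 &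
    forall x, Om x -> \sum_i `|X i x| <= M1.
  have cn : continuous (fun x => \sum_i `|X i x|).
    apply: continuous_sum_ord => i x.
    by apply: (@continuous_comp _ _ _ (X i));
      [exact: C1_continuous|exact: norm_continuous].
  have [M1 M10 h] := continuous_bounded_on cn bOm.
  by exists M1 => // x /h; apply: le_trans; exact: ler_norm.
pose M := M0 + M1.
have M_gt0 : 0 < M by rewrite addr_gt0.
pose C := 8 * M * (2 * plateau_radius d) ^+ d.
have k0 : 0 < plateau_radius d :> R by rewrite mulr_gt0.
have C0 : 0 <= C by rewrite !mulr_ge0 ?exprn_ge0 ?mulr_ge0 ?ltW.
have main e : 0 < e <= 1 -> `|integral_over Om (divergence X)| <= C * e.
  move=> /andP[e0 e1].
  have [s [s0 scov ssum]] := nullS e e0.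
  (* a radius above 1 would alone exceed the total [e]; this uses d > 1 *)
  have s01 q : q \in s -> 0 < q.2 <= 1.
    move=> qs; rewrite s0//= leNgt; apply/negP => q1.
    move: ssum; apply/negP; rewrite -leNgt (le_trans e1)//.
    apply: (@le_trans _ _ (q.2 ^+ d.-1)); first by rewrite exprn_ege1// ltW.
    rewrite (big_rem q)//= lerDl big_seq; apply: sumr_ge0 => q' /mem_rem/s0 h.
    by rewrite exprn_ge0// ltW.
  have [chi [hchi chi01 chi0 chi1 dchi]] := cutoff_balls s01.
  have hY := C1_scale_field hchi hX.
  have tY := tangential_scale chi tX.
  pose U := \bigcup_(q in [set` s]) ball q.1 q.2.
  have oU : open U by apply: bigcup_open => q _; exact: ball_open.
  pose K := closure Om `&` ~` U.
  have cK : compact K.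
    apply: bounded_closed_compact.
      by apply: bounded_subset (bounded_closure bOm) => x [].
    by apply: closedI; [exact: closed_closure|exact: open_closedC].
  pose D := [set q : 'rV[R]_d * R |
    0 < q.2 /\ null_divergence Om q.1 (plateau_radius d * q.2)].
  have Kcov : K `<=` cover D (fun q => ball q.1 q.2).
    move=> x [cx nUx].
    have nS : ~ singular_boundary Om x.
      by move=> /scov[q qs xq]; apply: nUx; exists q.
    have [r r0 hr] := null_divergence_exists oOm cx nS.
    exists (x, r / plateau_radius d); last by apply: ballxx; rewrite divr_gt0.
    split; first by rewrite divr_gt0.
    by rewrite /= mulrC divfK// gt_eqF.
  have oD q : D q -> open (ball q.1 q.2) by move=> _; exact: ball_open.
  move: cK; rewrite compact_cover => /(_ _ D _ oD Kcov)[L LD KL].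
  have int0 : integral_over Om (divergence (scale_field chi X)) = 0.
    apply: (@integral_divergence_cover Om (enum_fset L)) => //.
      by move=> q /LD; rewrite inE.
    move=> x Ox nL i; rewrite /scale_field.
    have [[q qs xq]|nU] := pselect (U x); first by rewrite (chi0 q)// mul0r.
    have [q qL xq] : cover [set` L] (fun q => ball q.1 q.2) x.
      by apply: KL; split => //; exact: subset_closure.
    by case: (nL q).
  rewrite -[integral_over _ _]subr0 -int0 -integral_overB//; last first.
    exact: continuous_divergence.
  apply: (@le_trans _ _ (\sum_(q <- [seq (ball q.1 (plateau_radius d * q.2),
      8 / q.2 * M) | q <- s]) q.2 * fine (vol q.1))).
    apply: integral_over_bound => //.
    - move=> x; apply: (@continuousB _ _ _ (divergence X)
        (divergence (scale_field chi X))); first exact: cdiv.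
      exact: continuous_divergence.
    - move=> _ /mapP[q qs ->] /=; have /andP[q0 _] := s01 _ qs; split.
      + by apply: ball_open; rewrite mulr_gt0.
      + exact: bounded_ball.
      + by rewrite mulr_ge0 ?divr_ge0 ?ltW.
    move=> x Ox; rewrite big_map /=.
    under eq_bigr do rewrite mulrAC.
    rewrite -mulr_suml divergence_scale// opprD addrA -[X in X - _ - _]mul1r.
    rewrite -mulrBl (le_trans (ler_normB _ _))// mulrDr lerD//.
      have /andP[c0 c1] := chi01 x.
      by rewrite normrM ger0_norm ?subr_ge0// ler_pM ?subr_ge0 ?hM0.
    rewrite (le_trans (ler_norm_sum _ _ _))//.
    set N := \sum_(q <- s) _.
    apply: (@le_trans _ _ (\sum_i N * `|X i x|)).
      by apply: ler_sum => i _; rewrite normrM ler_wpM2r// dchi.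
    have N0 : 0 <= N.
      by apply: le_trans (chi1 x); rewrite subr_ge0; have /andP[] := chi01 x.
    by rewrite -mulr_sumr ler_wpM2l// hM1.
  rewrite big_map /= (@eq_big_seq _ _ _ _ _ _ (fun q => C * q.2 ^+ d.-1)).
    by rewrite -mulr_sumr ler_wpM2l// ltW.
  move=> q qs /=; have /andP[q0 _] := s01 _ qs.
  rewrite vol_ball ?mulr_gt0//= /C.
  have q1 : q.2 ^+ d = q.2 ^+ d.-1 * q.2 by rewrite -exprSr prednK// ltnW.
  rewrite mulrA exprMn q1; field; exact: lt0r_neq0.
apply/eqP; rewrite -normr_le0; apply/ler_addgt0Pr => e e0; rewrite add0r.
have C1_gt0 : 0 < C + 1 by rewrite ltr_wpDl.
have h0 : 0 < Num.min 1 (e / (C + 1)) by rewrite lt_min ltr01 divr_gt0.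
apply: (le_trans (main (Num.min 1 (e / (C + 1))) _)).
  by rewrite h0 ge_min lexx.
apply: (@le_trans _ _ (C * (e / (C + 1)))).
  by rewrite ler_wpM2l// ge_min lexx orbT.
by rewrite mulrA ler_pdivrMr// mulrC ler_wpM2l ?(ltW e0)// lerDl.
Qed.

End divergence_theorem.

(** * Green identity and energy balance *)

Section green.
Context {R : realType} {d : nat}.
Implicit Types (S : setting R d) (u v : 'rV[R]_d -> R).

Lemma open_domain S : admissible_domain S -> open (domain S).
Proof. by case: S => [a b _|Om []] //; exact: (@open_open_box R d a b). Qed.

Lemma bounded_domain S : admissible_domain S -> bounded_set (domain S).
Proof. by case: S => [a b _|Om []] //; exact: (@bounded_open_box R d a b). Qed.

Lemma derive_sum_partial u (p n : 'rV[R]_d) : differentiable u p ->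
  'D_n u p = \sum_i n 0 i * partial i u p.
Proof.
move=> du; rewrite deriveE// {1}(row_sum_delta n) linear_sum.
by apply: eq_bigr => i _; rewrite linearZ /= /partial deriveE.
Qed.

Lemma partial_periodic i u (w : 'rV[R]_d) : (forall x, u (x + w) = u x) ->
  forall x, partial i u (x + w) = partial i u x.
Proof.
move=> uw x; rewrite /partial /derive; 
rewrite [X in lim (X @ _) = _](_ : _ = fun h : R =>
  h^-1 *: ((u \o shift x) (h *: delta_mx 0 i) - u x))//.
by apply/funext => h /=; rewrite addrA !uw.
Qed.

Lemma boundary_conditionB S u v : C1 u -> C1 v ->
  boundary_condition S u -> boundary_condition S v ->
  boundary_condition S (fun x => u x - v x).
Proof.
case: S => [a b|Om] hu hv bu bv /=; first by move=> i x; rewrite bu bv.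
move=> p n hn; rewrite (@deriveB _ _ _ u v).
- by rewrite (bu p n hn) (bv p n hn) subrr.
- exact/diff_derivable/(hu.1 p).
- exact/diff_derivable/(hv.1 p).
Qed.

(** The field [v * grad u] has zero total divergence: in the periodic case it is
    periodic, otherwise its normal component is a multiple of that of
    [grad u]. *)
Lemma green_first_identity S u v : (1 < d)%N -> admissible_domain S ->
  C1 v -> C2 u -> boundary_condition S v -> boundary_condition S u ->
  integral_over (domain S) (fun x => v x * laplacian u x) =
  - integral_over (domain S) (fun x => \sum_i partial i v x * partial i u x).
Proof.
move=> d1 hS hv [hu hdu] bv bu.
pose Y : 'I_d -> 'rV[R]_d -> R := scale_field v (fun i => partial i u).
have hY : forall i, C1 (Y i) := C1_scale_field hv hdu.
have cl : continuous (fun x => v x * laplacian u x).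
  move=> x; apply: (@continuousM _ _ v (laplacian u)).
    exact: C1_continuous.
  exact: (continuous_divergence hdu).
have cf : continuous (flux v (fun i => partial i u)) by exact: continuous_flux.
apply/eqP; rewrite -subr_eq0 opprK -integral_overD//; last 2 first.
- exact: open_domain.
- exact: bounded_domain.
rewrite -[X in integral_over _ X](divergence_scale hv hdu) -/Y; apply/eqP.
case: S hS bv bu => [a b|Om] hS bv bu; last first.
  apply: divergence_theorem => // p n hn.
  rewrite /Y /scale_field; under eq_bigr do rewrite mulrCA.
  rewrite -mulr_sumr -derive_sum_partial; last exact: hu.1.
  by rewrite bu// mulr0.
rewrite integral_over_sum; last 3 first.
- exact: open_open_box.
- exact: bounded_open_box.
- by move=> i; exact: (hY i).2.
rewrite big1// => i _; apply: integral_box_partial => // x _.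
by rewrite /Y /scale_field bv (partial_periodic _ (bu i)).
Qed.

End green.

Section energy_identity.
Context {R : realType} {d : nat}.
Implicit Types (S : setting R d) (u v phi : 'rV[R]_d -> R) (F : R -> R).

Lemma smooth_continuous F : smooth F -> continuous F.
Proof.
move=> hF x; apply: differentiable_continuous; apply/derivable1_diffP.
exact: (hF 0%N x).
Qed.

Lemma smooth_derive1_continuous F : smooth F -> continuous (derive1 F).
Proof.
move=> hF x; apply: differentiable_continuous; apply/derivable1_diffP.
exact: (hF 1%N x).
Qed.

Lemma midpointE u v : midpoint u v = fun x => 2^-1 * (u x + v x).
Proof. by apply/funext => x; rewrite /midpoint mulrC. Qed.

Lemma C1_midpoint u v : C1 u -> C1 v -> C1 (midpoint u v).
Proof. by move=> hu hv; rewrite midpointE; exact/C1Z/C1D. Qed.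

Lemma partial_midpoint i u v : C1 u -> C1 v ->
  partial i (midpoint u v) = midpoint (partial i u) (partial i v).
Proof.
by move=> hu hv; rewrite !midpointE (partialZ _ _ (C1D hu hv)) (partialD _ hu hv).
Qed.

Lemma admissible_midpoint S u v : admissible S u -> admissible S v ->
  admissible S (midpoint u v).
Proof.
move=> [[hu hdu] bu] [[hv hdv] bv]; split.
  split; first exact: C1_midpoint.
  by move=> i; rewrite partial_midpoint//; exact: C1_midpoint.
case: S bu bv => [a b|Om] bu bv /=; first by move=> i x; rewrite /midpoint bu bv.
move=> p n hn; rewrite derive_sum_partial; last exact: (C1_midpoint hu hv).1.
under eq_bigr do rewrite partial_midpoint// mulrA mulrDr mulrDl.
rewrite big_split /= -!mulr_suml -!derive_sum_partial; [|exact: hv.1|exact: hu.1].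
by rewrite bu// bv// !mul0r addr0.
Qed.

Lemma continuous_sqnorm2_grad u : C2 u -> continuous (fun x => sqnorm2 (grad u x)).
Proof.
move=> [_ hu]; apply: continuous_sum_ord => i.
rewrite (_ : (fun x => _) = fun x => partial i u x * partial i u x).
  by apply/C1_continuous/C1M.
by apply/funext => x; rewrite mxE expr2.
Qed.

Lemma energyE S (eps : R) F phi : admissible_domain S -> continuous F ->
  C2 phi -> energy S eps F phi =
  eps ^+ 2 / 2 * integral_over (domain S) (fun x => sqnorm2 (grad phi x)) +
  integral_over (domain S) (F \o phi).
Proof.
move=> hS cF hphi; have cg := continuous_sqnorm2_grad hphi.
have cFp : continuous (F \o phi).
  move=> x; apply: continuous_comp; last exact: cF.
  exact: (C1_continuous hphi.1).
have oS := open_domain hS; have bS := bounded_domain hS.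
rewrite /energy -integral_overZ// -integral_overD//.
move=> x; apply: (@continuousM _ _ (fun=> eps ^+ 2 / 2)
  (fun x => sqnorm2 (grad phi x))); [exact: cst_continuous|exact: cg].
Qed.

Section step.
Variables (S : setting R d).
Hypotheses (d1 : (1 < d)%N) (hS : admissible_domain S).

Let oS := open_domain hS.
Let bS := bounded_domain hS.
Local Notation I := (integral_over (domain S)).

(** The midpoint rule makes the gradient terms an exact difference of energies:
    [(a - b) * (a + b) / 2 = (a ^ 2 - b ^ 2) / 2]. *)
Lemma integral_diff_laplacian_midpoint u v :
  admissible S u -> admissible S v ->
  I (fun x => (u x - v x) * laplacian (midpoint u v) x) =
  - (2^-1 * (I (fun x => sqnorm2 (grad u x)) - I (fun x => sqnorm2 (grad v x)))).
Proof.
move=> au av; have [hm bm] := admissible_midpoint au av.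
have [[hu hdu] bu] := au; have [[hv hdv] bv] := av.
have cgu := continuous_sqnorm2_grad au.1; have cgv := continuous_sqnorm2_grad av.1.
apply: (etrans (green_first_identity d1 hS (C1B hu hv) hm
  (boundary_conditionB hu hv bu bv) bm)).
congr (- _); apply: (etrans _ (congr1 _ (integral_overB oS bS cgu cgv))).
have cguv : continuous (fun x => sqnorm2 (grad u x) - sqnorm2 (grad v x)).
  move=> x; apply: (@continuousB _ _ _ (fun x => sqnorm2 (grad u x))
    (fun x => sqnorm2 (grad v x))); [exact: cgu|exact: cgv].
apply: (etrans _ (integral_overZ oS bS 2^-1 cguv)).
apply: integral_over_ext => x _; rewrite /sqnorm2 -sumrB mulr_sumr.
apply: eq_bigr => i _.
rewrite !mxE (partialB _ hu hv) (partial_midpoint _ hu hv) /midpoint.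
by move: (partial i u x) (partial i v x) => a b; field.
Qed.

(** Green's identity turns [m * laplacian m] into the dissipation; there is no
    boundary term because [m] itself satisfies the boundary condition. *)
Lemma integral_mul_flow (dt : R) u v m : 0 < dt -> C2 m ->
  boundary_condition S m ->
  (forall x, domain S x -> (u x - v x) / dt = laplacian m x) ->
  I (fun x => m x * (u x - v x)) = - (dt * L2norm_sq_grad S m).
Proof.
move=> dt0 hm bm hflow.
have cml : continuous (fun x => m x * laplacian m x).
  move=> x; apply: (@continuousM _ _ m (laplacian m)).
    exact: (C1_continuous hm.1).
  exact: (continuous_divergence hm.2).
transitivity (dt * I (fun x => m x * laplacian m x)).
  apply: (etrans _ (integral_overZ oS bS dt cml)); apply: integral_over_ext => x Sx.
  by rewrite -hflow// mulrCA [dt * _]mulrC divfK// lt0r_neq0.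
rewrite -mulrN; congr (_ * _).
apply: (etrans (green_first_identity d1 hS hm.1 hm bm bm)); congr (- _).
apply: integral_over_ext => x _; apply: eq_bigr => i _.
by rewrite mxE expr2.
Qed.

(** The test with the increment yields the energy difference up to the
    linearisation error of the nonlinear part, which is what [RAV_Q] records. *)
Lemma integral_mul_potential (eps lam : R) F ps u v m : continuous F ->
  continuous (derive1 F) -> continuous ps -> admissible S u -> admissible S v ->
  (forall x, domain S x -> m x = - eps ^+ 2 * laplacian (midpoint u v) x +
    lam * midpoint u v x + derive1 F (ps x) - lam * ps x) ->
  I (fun x => m x * (u x - v x)) =
  energy S eps F u - energy S eps F v +
  (I (fun x => (derive1 F (ps x) - lam * ps x) * (u x - v x)) -
   (I (fun x => F (u x) - lam / 2 * u x ^+ 2) -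
    I (fun x => F (v x) - lam / 2 * v x ^+ 2))).
Proof.
move=> cF cF' cps au av hm.
have cu := C1_continuous au.1.1; have cv := C1_continuous av.1.1.
have cM (f g : 'rV[R]_d -> R) : continuous f -> continuous g ->
    continuous (fun x => f x * g x).
  by move=> cf cg x; apply: (@continuousM _ _ f g); [exact: cf|exact: cg].
have cB (f g : 'rV[R]_d -> R) : continuous f -> continuous g ->
    continuous (fun x => f x - g x).
  by move=> cf cg x; apply: (@continuousB _ _ _ f g); [exact: cf|exact: cg].
have cD (f g : 'rV[R]_d -> R) : continuous f -> continuous g ->
    continuous (fun x => f x + g x).
  by move=> cf cg x; apply: (@continuousD _ _ _ f g); [exact: cf|exact: cg].
have cZ (c : R) (f : 'rV[R]_d -> R) : continuous f ->
    continuous (fun x => c * f x).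
  by move=> cf; apply: cM => //; exact: cst_continuous.
have cC (h : R -> R) (f : 'rV[R]_d -> R) : continuous h -> continuous f ->
    continuous (fun x => h (f x)).
  by move=> ch cf x; apply: continuous_comp; [exact: cf|exact: ch].
have c2 (f : 'rV[R]_d -> R) : continuous f -> continuous (fun x => f x ^+ 2).
  by move=> cf; exact: (cM f f).
have cw := cB _ _ cu cv.
have cl : continuous (fun x => (u x - v x) * laplacian (midpoint u v) x).
  by apply: cM => //; exact: (continuous_divergence (admissible_midpoint au av).1.2).
have cn : continuous (fun x => (derive1 F (ps x) - lam * ps x) * (u x - v x)).
  by apply: cM => //; apply: cB; [exact: cC|exact: cZ].
have cq := cB _ _ (c2 _ cu) (c2 _ cv).
have c3 := cD _ _ (cZ (- eps ^+ 2) _ cl) (cZ (lam / 2) _ cq).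
have split_m : I (fun x => m x * (u x - v x)) =
    - eps ^+ 2 * I (fun x => (u x - v x) * laplacian (midpoint u v) x) +
    lam / 2 * (I (fun x => u x ^+ 2) - I (fun x => v x ^+ 2)) +
    I (fun x => (derive1 F (ps x) - lam * ps x) * (u x - v x)).
  apply: (etrans (y := I (fun x =>
    (- eps ^+ 2 * ((u x - v x) * laplacian (midpoint u v) x) +
     lam / 2 * (u x ^+ 2 - v x ^+ 2)) +
    (derive1 F (ps x) - lam * ps x) * (u x - v x)))).
    apply: integral_over_ext => x Sx; rewrite (hm x Sx).
    move: (laplacian _ x) (derive1 F (ps x)) => L f; rewrite /midpoint.
    by move: (u x) (v x) (ps x) => a b y; field.
  apply: (etrans (integral_overD oS bS c3 cn)); congr (_ + _).
  apply: (etrans (integral_overD oS bS (cZ _ _ cl) (cZ _ _ cq))); congr (_ + _).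
    exact: (integral_overZ oS bS _ cl).
  apply: (etrans (integral_overZ oS bS _ cq)); congr (_ * _).
  exact: (integral_overB oS bS (c2 _ cu) (c2 _ cv)).
have splitF (f : 'rV[R]_d -> R) : continuous f ->
    I (fun x => F (f x) - lam / 2 * f x ^+ 2) =
    I (F \o f) - lam / 2 * I (fun x => f x ^+ 2).
  move=> cf; apply: (etrans (integral_overB oS bS (cC _ _ cF cf)
    (cZ (lam / 2) _ (c2 _ cf)))); congr (_ - _).
  exact: (integral_overZ oS bS _ (c2 _ cf)).
have Eu := energyE eps hS cF au.1; have Ev := energyE eps hS cF av.1.
have G := integral_diff_laplacian_midpoint au av.
move: split_m (splitF u cu) (splitF v cv) Eu Ev G.
move: (energy S eps F u) (energy S eps F v) (I (fun x => m x * (u x - v x))).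
move: (I (fun x => (u x - v x) * laplacian (midpoint u v) x)).
move: (I (fun x => (derive1 F (ps x) - lam * ps x) * (u x - v x))).
move: (I (fun x => F (u x) - lam / 2 * u x ^+ 2)).
move: (I (fun x => F (v x) - lam / 2 * v x ^+ 2)).
move: (I (F \o u)) (I (F \o v)) (I (fun x => u x ^+ 2)) (I (fun x => v x ^+ 2)).
move: (I (fun x => sqnorm2 (grad u x))) (I (fun x => sqnorm2 (grad v x))).
by move=> ? ? ? ? ? ? ? ? ? ? ? ? ? -> -> -> -> -> ->; field.
Qed.

(** [Q - r] is the linearisation error plus the dissipation, so equating the two
    tests leaves an equality, whatever the time step. *)
Lemma energy_balance (eps lam dt C0 : R) F n
    (phi phibar mu : nat -> 'rV[R]_d -> R) (r Q xi : nat -> R) :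
  0 < dt -> smooth F ->
  admissible S (phi n) -> admissible S (phi n.+1) -> admissible S (mu n) ->
  admissible S (phibar n) -> admissible S (phibar n.-1) ->
  RAV2_step S eps F lam dt C0 n phi phibar mu r Q xi ->
  energy S eps F (phi n.+1) - energy S eps F (phi n) = r n - Q n.+1.
Proof.
move=> dt0 sF a0 a1 [C2m bm] [C2b0 _] [C2b1 _] [hphi hmu -> _ _ _ _].
have cps : continuous (extrapolation (phibar n) (phibar n.-1)).
  by apply: C1_continuous; apply: C1B; apply: C1Z; [exact: C2b0.1|exact: C2b1.1].
have := integral_mul_potential (smooth_continuous sF)
  (smooth_derive1_continuous sF) cps a1 a0 hmu.
rewrite (integral_mul_flow dt0 C2m bm hphi) /RAV_Q.
move: (energy _ _ _ _) (energy _ _ _ _) (L2norm_sq_grad _ _) => e1 e0 L.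
by move: (I _) (I _) (I _) => i1 i2 i3 h; lra.
Qed.

End step.

End energy_identity.

Unset Implicit Arguments.

Theorem theorem2p1 (R : realType) (d : nat) (hd : d = 2%N \/ d = 3%N)
    (S : setting R d) (hS : admissible_domain S)
    (eps lam dt C0 : R) (heps : 0 < eps) (hlam : 0 < lam) (hdt : 0 < dt)
    (F : R -> R) (hF : smooth F)
    (hC0 : forall u : 'rV[R]_d -> R, admissible S u -> 0 < energy S eps F u + C0)
    (n : nat) (hn : (1 <= n)%N)
    (phi phibar mu : nat -> 'rV[R]_d -> R) (r Q xi : nat -> R)
    (hphi0 : admissible S (phi n)) (hphi1 : admissible S (phi n.+1))
    (hmu : admissible S (mu n))
    (hphibar0 : admissible S (phibar n)) (hphibarm1 : admissible S (phibar n.-1))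
    (hstep : RAV2_step S eps F lam dt C0 n phi phibar mu r Q xi) :
  [/\ 0 <= Q n.+1 ->
        energy S eps F (phi n.+1) - (energy S eps F (phi n) + r n)
          = energy S eps F (phi n.+1) + r n.+1 - (energy S eps F (phi n) + r n)
        /\ energy S eps F (phi n.+1) + r n.+1
             - (energy S eps F (phi n) + r n) <= 0,
      Q n.+1 < 0 ->
        energy S eps F (phi n.+1) + r n.+1 - (energy S eps F (phi n) + r n) = 0
    & 0 <= Q n.+1 - r n ->
        energy S eps F (phi n.+1) - energy S eps F (phi n) <= 0].
Proof.
have d1 : (1 < d)%N by case: hd => ->.
have E := energy_balance d1 hS hdt hF hphi0 hphi1 hmu hphibar0 hphibarm1 hstep.
split => hQ.
- by rewrite (RAV2_r_ge0 hstep hQ) addr0; split => //; lra.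
- by rewrite (RAV2_r_lt0 hstep hQ); lra.
- by rewrite E; lra.
Qed.
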